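(* For the curvature invariants $|\nabla R|^2$, $\hat R$, $\overset{\circ}{R}$ of $(G(j),g(j))$, where $j:\mathfrak z=\mathbb R^r\to\mathfrak{so}(\mathfrak v)=\mathfrak{so}(m)$ is a linear map, we have (i) $|\nabla R|^2=-\tfrac32I_{\alpha\beta\gamma|\alpha\beta\gamma}+L_1$, (ii) $\hat R=-\tfrac7{16}I_{\alpha\beta\gamma|\alpha\beta\gamma}+L_2$, (iii) $\overset{\circ}{R}=-\tfrac{17}{64}I_{\alpha\beta\gamma|\alpha\beta\gamma}+L_3$, where $L_1,L_2,L_3$ are universal linear combinations of certain other invariants $I_{k_1\ldots k_\lambda|\ldots|k_\mu\ldots k_6}(j)$ in which all occurring subtuples $(k_1,\dots,k_\lambda),\dots,(k_\mu,\dots,k_6)$ are of even length.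
   Context: $\mathfrak v=\mathbb R^m$, $\mathfrak z=\mathbb R^r$ carry the standard inner products. Given a linear map $j:\mathfrak z\to\mathfrak{so}(\mathfrak v)$, $Z\mapsto j_Z$, let $\mathfrak g(j)$ be the two-step nilpotent metric Lie algebra with underlying vector space $\mathfrak v\oplus\mathfrak z$, standard inner product, and bracket defined by: $\mathfrak z$ is central, $[\mathfrak v,\mathfrak v]\subseteq\mathfrak z$, and $\langle j_ZX,Y\rangle=\langle Z,[X,Y]\rangle$ for $X,Y\in\mathfrak v$, $Z\in\mathfrak z$. $G(j)$ is the simply connected Lie group with Lie algebra $\mathfrak g(j)$, endowed with the left invariant Riemannian metric $g(j)$ given by this inner product at the identity. Let $\{Z_1,\dots,Z_r\}$ be an orthonormal basis of $\mathfrak z$. For $q\in\mathbb N$ and each tuple $(k_1,\dots,k_{2q})$ arising as a permutation of $(1,1,2,2,\dots,q,q)$, divided into consecutive subtuples $(k_1,\dots,k_\lambda),\dots,(k_\mu,\dots,k_{2q})$, define $$I_{k_1\ldots k_\lambda|\ldots|k_\mu\ldots k_{2q}}(j):=\sum\mathrm{Tr}(j_{Z_{\alpha_{k_1}}}\cdots j_{Z_{\alpha_{k_\lambda}}})\cdots\mathrm{Tr}(j_{Z_{\alpha_{k_\mu}}}\cdots j_{Z_{\alpha_{k_{2q}}}}),$$ where the sum runs over all $(\alpha_1,\dots,\alpha_q)\in\{1,\dots,r\}^q$. In particular $I_{\alpha\beta\gamma|\alpha\beta\gamma}=I_{123|123}(j)=\sum_{\alpha,\beta,\gamma=1}^r(\mathrm{Tr}(j_{Z_\alpha}j_{Z_\beta}j_{Z_\gamma}))^2$.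 ''Universal'' means that the coefficients do not depend on $j$, $m$, $r$. Curvature conventions: $R(X,Y)=\nabla_{[X,Y]}-[\nabla_X,\nabla_Y]$ and $R_{ijkl}=\langle R(e_i,e_j)e_k,e_l\rangle$ for an orthonormal basis $\{e_i\}$ of the tangent space. With the Einstein summation convention (sum over repeated indices), $\hat R:=R_{ijkl}R_{klpq}R_{pqij}$ and $\overset{\circ}{R}:=R_{ikjl}R_{kplq}R_{piqj}$; $|\nabla R|^2$ is the sum of the squares of all components of $\nabla R$. By homogeneity these are constant functions. *)

(* Defs.v *)
From HB Require Import structures.
From mathcomp Require Import all_boot all_order all_algebra.
From mathcomp Require Import boolp classical_sets functions reals.
From mathcomp Require Import topology tvs normedtype derive.

Set Implicit Arguments.
Unset Strict Implicit.
Unset Printing Implicit Defensive.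

Import GRing.Theory Num.Theory.
Import numFieldNormedType.Exports.

Local Open Scope ring_scope.

Section RiemannianGeometry.
Context {R : realType} {n : nat}.
Local Notation E := 'cV[R]_n.

(* The manifold is R^n with its global chart: tangent spaces are identified
   with E, and vector fields are functions E -> E. *)

Implicit Types (f : E -> R) (X Y Z W : E -> E).
Implicit Types (nabla : (E -> E) -> (E -> E) -> E -> E).

(* f is of class C^k: all iterated partial derivatives of order at most k
   exist and are continuous. *)
Fixpoint is_Ck (k : nat) f : Prop :=
  if k is k'.+1 then
    continuous f /\
    forall v : E, (forall x, derivable f x v) /\ is_Ck k' ('D_v f)
  else continuous f.

Definition smooth f : Prop := forall k, is_Ck k f.

Definition smooth_field X : Prop := forall i, smooth (fun p => X p i 0).

Definition lie_derivative X f : E -> R := fun p => 'D_(X p) f p.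

(* [X, Y] f = X (Y f) - Y (X f), written in the global chart. *)
Definition lie_bracket X Y : E -> E := fun p => \col_i
  (lie_derivative X (fun q => Y q i 0) p - lie_derivative Y (fun q => X q i 0) p).

(* g p is the scalar product on the tangent space at p; nabla X Y stands for
   nabla_X Y, whose value is relevant only on smooth X and Y. *)
Record is_levi_civita (g : E -> E -> E -> R) nabla : Prop := IsLeviCivita {
  nabla_smooth : forall X Y, smooth_field X -> smooth_field Y ->
    smooth_field (nabla X Y) ;
  nablaDl : forall X X' Y,
    smooth_field X -> smooth_field X' -> smooth_field Y ->
    nabla (X + X') Y = nabla X Y + nabla X' Y ;
  nablaZl : forall f X Y, smooth f -> smooth_field X -> smooth_field Y ->
    nabla (fun p => f p *: X p) Y = fun p => f p *: nabla X Y p ;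
  nablaDr : forall X Y Y',
    smooth_field X -> smooth_field Y -> smooth_field Y' ->
    nabla X (Y + Y') = nabla X Y + nabla X Y' ;
  nabla_leibniz : forall f X Y, smooth f -> smooth_field X -> smooth_field Y ->
    nabla X (fun p => f p *: Y p) =
    fun p => lie_derivative X f p *: Y p + f p *: nabla X Y p ;
  nabla_metric : forall X Y Z,
    smooth_field X -> smooth_field Y -> smooth_field Z ->
    lie_derivative X (fun p => g p (Y p) (Z p)) =
    fun p => g p (nabla X Y p) (Z p) + g p (Y p) (nabla X Z p) ;
  nabla_torsion_free : forall X Y, smooth_field X -> smooth_field Y ->
    nabla X Y - nabla Y X = lie_bracket X Y
}.

(* R(X, Y) Z, with the sign convention
   R(X, Y) = nabla_[X, Y] - [nabla_X, nabla_Y]. *)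
Definition curvature nabla X Y Z : E -> E :=
  nabla (lie_bracket X Y) Z - (nabla X (nabla Y Z) - nabla Y (nabla X Z)).

(* (nabla_X R)(Y, Z) W *)
Definition nabla_curvature nabla X Y Z W : E -> E :=
  nabla X (curvature nabla Y Z W) - curvature nabla (nabla X Y) Z W
  - curvature nabla Y (nabla X Z) W - curvature nabla Y Z (nabla X W).

(* The frame consists of vector fields, but only its values at p have to be
   orthonormal: the e i are extensions of an orthonormal basis of the tangent
   space at p, as needed to evaluate tensors given in terms of fields. *)
Definition orthonormal_frame_at (g : E -> E -> E -> R) (p : E)
    (e : 'I_n -> E -> E) : Prop :=
  (forall i, smooth_field (e i)) /\
  (forall i j, g p (e i p) (e j p) = (i == j)%:R).

Section Invariants.
Variables (g : E -> E -> E -> R) (nabla : (E -> E) -> (E -> E) -> E -> E).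
Variables (p : E) (e : 'I_n -> E -> E).

Definition Rm (i j k l : 'I_n) : R :=
  g p (curvature nabla (e i) (e j) (e k) p) (e l p).

Definition nabla_Rm (s i j k l : 'I_n) : R :=
  g p (nabla_curvature nabla (e s) (e i) (e j) (e k) p) (e l p).

Definition norm_nabla_R_sqr : R :=
  \sum_s \sum_i \sum_j \sum_k \sum_l nabla_Rm s i j k l ^+ 2.

Definition R_hat : R :=
  \sum_i \sum_j \sum_k \sum_l \sum_a \sum_b
    Rm i j k l * Rm k l a b * Rm a b i j.

Definition R_ring : R :=
  \sum_i \sum_j \sum_k \sum_l \sum_a \sum_b
    Rm i k j l * Rm k a l b * Rm a i b j.

End Invariants.

End RiemannianGeometry.

Section TwoStepNilpotent.
Context {R : realType}.

Definition dot {n : nat} (u v : 'cV[R]_n) : R := \sum_i u i 0 * v i 0.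

Definition orthonormal_basis {n : nat} (b : 'I_n -> 'cV[R]_n) : Prop :=
  forall i k, dot (b i) (b k) = (i == k)%:R.

Definition so_valued {m r : nat} (j : 'cV[R]_r -> 'M[R]_m) : Prop :=
  forall Z, (j Z)^T = - j Z.

Context {m r : nat}.
Variable j : {linear 'cV[R]_r -> 'M[R]_m}.

(* 'cV_(m + r) is the orthogonal sum of v = 'cV_m (upper block) and
   z = 'cV_r (lower block). *)
Definition bracket_v (X Y : 'cV[R]_m) : 'cV[R]_r :=
  \col_a dot (j (delta_mx a 0) *m X) Y.

Lemma bracket_vP X Y Z : dot (j Z *m X) Y = dot Z (bracket_v X Y).
Proof.
rewrite {1}[Z]matrix_sum_delta linear_sum /= mulmx_suml /dot.
under eq_bigr => i _ do rewrite summxE mulr_suml.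
rewrite exchange_big; apply: eq_bigr => a _ /=.
rewrite mxE /dot mulr_sumr; apply: eq_bigr => i _.
by rewrite big_ord1 linearZ -scalemxAl mxE mulrA.
Qed.

Definition bracket (u w : 'cV[R]_(m + r)) : 'cV[R]_(m + r) :=
  col_mx 0 (bracket_v (usubmx u) (usubmx w)).

(* The simply connected group G(j) in exponential coordinates: the Lie algebra
   being two-step nilpotent, exp is a diffeomorphism and
   exp u * exp w = exp (u + w + [u, w] / 2). *)
Definition gmul (p q : 'cV[R]_(m + r)) : 'cV[R]_(m + r) :=
  p + q + 2^-1 *: bracket p q.

Definition ginv (p : 'cV[R]_(m + r)) : 'cV[R]_(m + r) := - p.

Lemma bracketDl u u' w : bracket (u + u') w = bracket u w + bracket u' w.
Proof.
rewrite /bracket add_col_mx addr0; congr col_mx; apply/colP => a.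
rewrite !mxE /dot -big_split; apply: eq_bigr => i _ /=.
by rewrite linearD /= mulmxDr mxE mulrDl.
Qed.

Lemma bracketDr u w w' : bracket u (w + w') = bracket u w + bracket u w'.
Proof.
rewrite /bracket add_col_mx addr0; congr col_mx; apply/colP => a.
rewrite !mxE /dot -big_split; apply: eq_bigr => i _ /=.
by rewrite !mxE mulrDr.
Qed.

Lemma bracket_xx u : so_valued j -> bracket u u = 0.
Proof.
move=> soj; rewrite /bracket [RHS](_ : 0 = col_mx 0 0); last by rewrite col_mx0.
congr col_mx; apply/colP => a; rewrite !mxE; set A := j _; set X := usubmx u.
have dotE (U W : 'cV[R]_m) : dot U W = (U^T *m W) 0 0.
  by rewrite mxE; apply: eq_bigr => i _; rewrite mxE.
have: dot (A *m X) X = - dot (A *m X) X.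
  rewrite {1}dotE trmx_mul soj mulmxN mulNmx -mulmxA mxE; congr (- _).
  by rewrite mxE /dot; apply: eq_bigr => i _; rewrite mxE mulrC.
by move/eqP; rewrite -subr_eq0 opprK -mulr2n mulrn_eq0 /= => /eqP.
Qed.

Lemma gmulA : associative gmul.
Proof.
move=> u v w; rewrite /gmul !(bracketDl, bracketDr).
have br0 x y z : bracket x (2^-1 *: bracket y z) = 0.
  rewrite /bracket scale_col_mx scaler0 col_mxKu -[RHS]col_mx0; congr col_mx.
  by apply/colP => a; rewrite !mxE /dot big1 // => i _; rewrite [X in _ * X]mxE mulr0.
have br0' x y z : bracket (2^-1 *: bracket y z) x = 0.
  rewrite /bracket scale_col_mx scaler0 col_mxKu -[RHS]col_mx0; congr col_mx.
  by apply/colP => a; rewrite !mxE /dot big1 // => i _; rewrite mulmx0 mxE mul0r.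
rewrite br0 br0' !addr0 !scalerDr.
set a := _ *: bracket u v; set b := _ *: bracket u w.
set c := _ *: bracket v w; rewrite !addrA.
by rewrite [u + v + a + w]addrAC [u + v + w + c + a]addrAC [LHS]addrAC.
Qed.

Lemma gmul0g : left_id 0 gmul.
Proof.
move=> u; rewrite /gmul add0r; have := bracketDl 0 0 u.
by rewrite addr0 => /esym/eqP; rewrite addrC -subr_eq0 addrK => /eqP->; rewrite scaler0 addr0.
Qed.

Lemma gmulVg : so_valued j -> left_inverse 0 ginv gmul.
Proof.
move=> soj u; rewrite /gmul /ginv addNr add0r.
have := bracketDl (- u) u u; rewrite addNr bracket_xx // addr0 => <-.
by have := gmul0g u; rewrite /gmul add0r => /eqP; rewrite -subr_eq0 addrC addKr => /eqP.
Qed.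

(* The left invariant metric: the left translation by p^-1 maps p to the
   identity 0, where the scalar product is the standard one. *)
Definition left_metric (p u w : 'cV[R]_(m + r)) : R :=
  dot ('d (gmul (ginv p)) p u) ('d (gmul (ginv p)) p w).

End TwoStepNilpotent.

Section TraceInvariants.
Context {R : realType} {q : nat}.

(* A tuple (k_1, ..., k_2q) divided into subtuples is given by the list of the
   latter; the labels 1, ..., q are represented by 'I_q. *)
Definition is_pattern (s : seq (seq 'I_q)) : bool :=
  all (fun b => b != [::]) s &&
  perm_eq (flatten s) (enum 'I_q ++ enum 'I_q).

Definition even_pattern (s : seq (seq 'I_q)) : bool :=
  is_pattern s && all (fun b => ~~ odd (size b)) s.

Context {m r : nat}.

Definition trace_invariant (Z : 'I_r -> 'cV[R]_r)
    (j : 'cV[R]_r -> 'M[R]_m) (s : seq (seq 'I_q)) : R :=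
  \sum_(a : {ffun 'I_q -> 'I_r})
    \prod_(b <- s) \tr (\big[mulmx/1%:M]_(k <- b) j (Z (a k))).

(* Linear combinations are finite lists of pairs (coefficient, pattern). *)
Definition even_combination (L : seq (R * seq (seq 'I_q))) : bool :=
  all (fun t => even_pattern t.2) L.

Definition combination_value (L : seq (R * seq (seq 'I_q)))
    (Z : 'I_r -> 'cV[R]_r) (j : 'cV[R]_r -> 'M[R]_m) : R :=
  \sum_(t <- L) t.1 * trace_invariant Z j t.2.

End TraceInvariants.

(* enum 'I_3 lists 0, 1, 2 in this order. *)
Definition pattern_123_123 : seq (seq 'I_3) := [:: enum 'I_3; enum 'I_3].

(* Main.v *)
Require Import Defs.
From HB Require Import structures.
From mathcomp Require Import all_boot all_order all_algebra.
From mathcomp Require Import boolp classical_sets functions reals.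
From mathcomp Require Import topology tvs normedtype derive.
From mathcomp Require Import ring lra.

(** Left invariance turns every curvature quantity into algebra. Let E_u be the
    left-invariant field with value u at the identity, and put
    c(x; y, z) = <y, j_x z>, which depends on the z-component of x and on the
    v-components of y and z only. Koszul's formula gives
    nabla_{E_u} E_v = E_{N(u, v)} with
    2 <N(u, v), w> = c(w; v, u) - c(u; w, v) + c(v; u, w)
    ([nabla_left_field]). The curvature R and its covariant derivative are
    tensors, so their components in an arbitrary frame depend only on the values
    of the frame at the point ([curvature_at], [nabla_curvature_at]; this is
    where the symmetry of second derivatives, [smooth_deriveC], enters). Left
    translation to the identity then expresses these components by N
    ([RmE], [nabla_RmE]).

    Full contractions do not depend on the orthonormal basis, so a basis adapted
    to the sum of v and z may be used. Each of the three invariants thereby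
    becomes a sum, over nine edges labelled by basis vectors, of signed products
    of six factors <N(x, y), z> in which every edge label occurs twice: a signed
    sum of cubic graphs with six vertices ([hat_sum], [ring_sum], [norm_sum]).
    Expanding N chooses at each vertex one of its three edges to carry the
    z-label of c. A choice contributes only if no edge is a z-edge at one end and
    a v-edge at the other ([clash_eq0]), that is, if the z-edges form a perfect
    matching. The v-edges then form disjoint cycles, and summing over their labels
    multiplies the maps j around each cycle and closes the cycle by a trace
    ([contract_val]). What remains is a sum over three z-labels of a product of
    traces of words containing every label twice, up to sign one of the
    invariants I ([contract_graph_val]).

    If some word has odd length, either one word has a single letter, with
    vanishing trace, or there are two words of length three. As
    Tr(abc) = - Tr(cba) for skew maps, the product of the latter is zero or, up to
    sign, the square of Tr(j_1 j_2 j_3) ([trace_word_triangle]). So only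
    I_{123|123} and even patterns occur.

    The graphs do not depend on j, m and r. The bookkeeping is therefore done once
    and for all by a function on labelled graphs, [reduce], which is proved
    correct and then evaluated. Counted with signs, I_{123|123} occurs -96, -28
    and -17 times for the squared norm of the derivative of R, for R-hat and for
    R-ring. The six factors 1/2 in the products give the coefficients -96/64,
    -28/64 and -17/64, and the even patterns produced by the evaluation, with
    coefficients 1/64 and -1/64, are the universal combinations L_1, L_2, L_3. *)

Set Implicit Arguments.
Unset Strict Implicit.
Unset Printing Implicit Defensive.

Import Order.TTheory GRing.Theory Num.Theory.
Import numFieldNormedType.Exports.

Local Open Scope ring_scope.

(** * Reduction of cubic graphs to products of traces *)

(** A vertex (A, B, C) stands for a factor g (rho A) (rho B) (rho C), where the
    edges A, B, C are numbered and rho assigns vectors to edges. The boolean is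
    the parity of the sign. *)
Notation vertex := (nat * nat * nat)%type (only parsing).
Notation graph_poly := (seq (bool * seq vertex)) (only parsing).

Definition gp_mul (P Q : graph_poly) : graph_poly :=
  [seq (s.1 (+) t.1, s.2 ++ t.2) | s <- P, t <- Q].

Definition gp_opp (P : graph_poly) : graph_poly := [seq (~~ s.1, s.2) | s <- P].

(** When vertices are factors c(x; y, z), an edge in the first slot must carry a
    z-vector and an edge in another slot a v-vector. *)
Definition clash (o : vertex) (s : seq vertex) : bool :=
  has (fun v => [|| o.1.1 == v.1.2, o.1.1 == v.2, v.1.1 == o.1.2 | v.1.1 == o.2])
      (o :: s).

(** The three summands of twice the connection form at a vertex. *)
Definition orientations (v : vertex) : graph_poly :=
  let: (A, B, C) := v in
  [:: (false, [:: (C, B, A)]); (true, [:: (A, C, B)]); (false, [:: (B, A, C)])].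

(** The tail is not inspected: [expand] filters every tail before extending it,
    which keeps the number of intermediate products small. *)
Definition clash_free (s : seq vertex) : bool :=
  if s is o :: s' then ~~ clash o s' else true.

Fixpoint expand (s : seq vertex) : graph_poly :=
  if s is v :: s' then
    [seq t <- gp_mul (orientations v) (expand s') | clash_free t.2]
  else [:: (false, [::])].

(** A strand (w, a, b) is the entry of the matrix product of the j with labels in
    w between the vectors on the open edges a and b. *)
Notation strand := (seq nat * nat * nat)%type (only parsing).

Definition end_at (y : nat) (f : strand) : bool * strand :=
  let: (w, a, b) := f in
  if b == y then (false, f) else (odd (size w), (rev w, b, a)).

(** Sums over the label of the v-edge y: y either closes a strand to a loop, or
    joins two strands, which are first turned so that both end at y. A state
    consists of a sign, of the words of the closed loops and of the strands.
    All that soundness needs is tested here, so no invariant about cubic graphs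
    has to be carried along. *)
Definition contract_edge (y : nat) (st : bool * seq (seq nat) * seq strand) :
    option (bool * seq (seq nat) * seq strand) :=
  let: (s, l, fs) := st in
  let at_y (f : strand) := (f.1.2 == y) || (f.2 == y) in
  if (y \in flatten l) || has (fun f : strand => y \in f.1.1) fs then None else
  let rest := [seq f <- fs | ~~ at_y f] in
  match [seq f <- fs | at_y f] with
  | [:: f] => if f.1.2 == f.2 then Some (s, f.1.1 :: l, rest) else None
  | [:: f1; f2] =>
    let: (s1, (w1, x, y1)) := end_at y f1 in
    let: (s2, (w2, z, y2)) := end_at y f2 in
    if [&& x != y, z != y, y1 == y & y2 == y] then
      Some (s (+) s1 (+) s2 (+) odd (size w2), l, (w1 ++ rev w2, x, z) :: rest)
    else None
  | _ => None
  end.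

(** The head of the list is contracted last, because in an iterated sum over the
    list it is the outermost summation. *)
Fixpoint contract (ys : seq nat) st :=
  if ys is y :: ys' then obind (contract_edge y) (contract ys' st) else Some st.

(** The z-edges, being those in a first slot, are renumbered 0, 1, 2; the words of
    the result form a pattern in these numbers. *)
Definition contract_graph (es : seq nat) (s : seq vertex) :
    option (bool * seq (seq nat)) :=
  let zs := [seq e <- es | e \in [seq v.1.1 | v <- s]] in
  let vs := [seq e <- es | e \notin [seq v.1.1 | v <- s]] in
  match contract vs (false, [::], [seq ([:: v.1.1], v.1.2, v.2) | v <- s]) with
  | Some (sg, l, [::]) =>
      if size zs == 3 then Some (sg, [seq [seq index k zs | k <- w] | w <- l])
      else None
  | _ => None
  end.

(** Sign relating the trace of a three-letter word to that of 012; the value is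
    [None] for words with a repeated letter, whose trace vanishes. *)
Definition triangle_sign (w : seq nat) : option bool :=
  if w \in [:: [:: 0; 1; 2]; [:: 1; 2; 0]; [:: 2; 0; 1]] then Some false else
  if w \in [:: [:: 2; 1; 0]; [:: 1; 0; 2]; [:: 0; 2; 1]] then Some true else None.

Notation pattern_poly := (seq (bool * seq (seq nat))) (only parsing).

Definition is_nat_pattern (l : seq (seq nat)) : bool :=
  all (fun w => w != [::]) l && perm_eq (flatten l) [:: 0; 1; 2; 0; 1; 2].

Definition normalize (t : bool * seq (seq nat)) : option pattern_poly :=
  let: (s, l) := t in
  if ~~ is_nat_pattern l then None else
  if all (fun w => ~~ odd (size w)) l then Some [:: t] else
  if has (fun w => size w == 1) l then Some [::] else
  if l is [:: w1; w2] then
    if (size w1 == 3) && (size w2 == 3) then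
    match triangle_sign w1, triangle_sign w2 with
    | Some s1, Some s2 =>
        Some [:: (s (+) s1 (+) s2, [:: [:: 0; 1; 2]; [:: 0; 1; 2]])]
    | _, _ => Some [::]
    end
    else None
  else None.

(** One failing term makes the result [None], so that a result [Some] vouches for
    every term. *)
Fixpoint collect A B (f : A -> option (seq B)) (s : seq A) : option (seq B) :=
  if s is x :: s' then
    obind (fun u => omap (cat u) (collect f s')) (f x)
  else Some [::].

Definition reduce (es : seq nat) (P : graph_poly) : option pattern_poly :=
  collect (fun t =>
    collect (fun u =>
      obind (fun v => normalize (t.1 (+) u.1 (+) v.1, v.2)) (contract_graph es u.2))
    (expand t.2)) P.

(** * Sums over labelled edges *)

Definition update {T : Type} (rho : nat -> T) (e : nat) (x : T) : nat -> T :=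
  fun k => if k == e then x else rho k.

Section IteratedSums.
Context {R : nzRingType} {T : Type} {I : finType} (w : I -> T).
Implicit Types (es : seq nat) (F G : (nat -> T) -> R) (rho : nat -> T).

Fixpoint isum es F rho : R :=
  if es is e :: es' then \sum_i isum es' F (update rho e (w i)) else F rho.

Lemma updateC rho e f x y : e != f -> update (update rho e x) f y = update (update rho f y) e x.
Proof.
move=> nef; apply/funext => k; rewrite /update.
by case: (eqVneq k f) => [->|//]; rewrite eq_sym (negbTE nef).
Qed.

Lemma eq_isum_in (P : (nat -> T) -> Prop) es F G rho :
  (forall rho e i, P rho -> P (update rho e (w i))) ->
  (forall rho, P rho -> F rho = G rho) -> P rho -> isum es F rho = isum es G rho.
Proof.
move=> Pupd FG; elim: es rho => [|e es IH] rho Prho /=; first exact: FG.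
by apply: eq_bigr => i _; apply: IH; apply: Pupd.
Qed.

Lemma eq_isum es F G rho : F =1 G -> isum es F rho = isum es G rho.
Proof. by move=> FG; apply: (@eq_isum_in (fun=> True)). Qed.

Lemma isum_lincomb (J : Type) (s : seq J) (c : J -> R) (F : J -> (nat -> T) -> R) es rho :
  isum es (fun rho => \sum_(t <- s) c t * F t rho) rho =
  \sum_(t <- s) c t * isum es (F t) rho.
Proof.
elim: es rho => [//|e es IH] rho /=.
under eq_bigr => i _ do rewrite IH.
by rewrite exchange_big; apply: eq_bigr => t _; rewrite mulr_sumr.
Qed.

Lemma isum_exchange (I' : finType) (v : I' -> T) e es F rho : e \notin es ->
  \sum_i isum es F (update rho e (v i)) =
  isum es (fun rho => \sum_i F (update rho e (v i))) rho.
Proof.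
elim: es rho => [//|f es IH] rho; rewrite inE negb_or => /andP[nef nes] /=.
rewrite exchange_big; apply: eq_bigr => k _; rewrite -IH //.
by apply: eq_bigr => i _; rewrite updateC.
Qed.

Lemma isum_split (p : pred nat) es F rho : uniq es ->
  isum es F rho =
  isum [seq e <- es | p e] (isum [seq e <- es | ~~ p e] F) rho.
Proof.
elim: es rho => [//|e es IH] rho /= /andP[nes ues].
case: (p e) => /=; first by apply: eq_bigr => i _; rewrite IH.
rewrite -isum_exchange; last by rewrite mem_filter (negbTE nes) andbF.
by apply: eq_bigr => i _; rewrite IH.
Qed.

End IteratedSums.

Lemma isum_cat (R : nzRingType) (T : Type) (I : finType) (w : I -> T)
    es es' (F : (nat -> T) -> R) rho :
  isum w (es ++ es') F rho = isum w es (isum w es' F) rho.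
Proof. by elim: es rho => [//|e es IH] rho /=; apply: eq_bigr => i _; rewrite IH. Qed.

(** * Values of graph polynomials *)

Section GraphPolynomials.
Context {R : comNzRingType} {T : Type}.
Implicit Types (g : T -> T -> T -> R) (rho : nat -> T) (P Q : graph_poly).

Definition mono g rho (s : seq vertex) : R :=
  \prod_(v <- s) g (rho v.1.1) (rho v.1.2) (rho v.2).

Definition gp_val g rho P : R := \sum_(t <- P) (-1) ^+ t.1 * mono g rho t.2.

Lemma gp_val_cat g rho P Q : gp_val g rho (P ++ Q) = gp_val g rho P + gp_val g rho Q.
Proof. exact: big_cat. Qed.

Lemma gp_val_opp g rho P : gp_val g rho (gp_opp P) = - gp_val g rho P.
Proof.
rewrite /gp_val big_map -sumrN; apply: eq_bigr => t _ /=.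
by rewrite signrN mulNr.
Qed.

Lemma gp_val_mul g rho P Q : gp_val g rho (gp_mul P Q) = gp_val g rho P * gp_val g rho Q.
Proof.
rewrite /gp_val big_allpairs_dep big_distrl; apply: eq_bigr => s _ /=.
rewrite big_distrr; apply: eq_bigr => t _ /=.
by rewrite signr_addb /mono big_cat mulrACA.
Qed.

(** The products discarded by the filter in [expand] have value zero, which is
    what the second hypothesis expresses. *)
Lemma gp_val_expand g c rho s :
  (forall A B C, g A B C = c C B A - c A C B + c B A C) ->
  (forall o s', clash o s' -> mono c rho (o :: s') = 0) ->
  mono g rho s = gp_val c rho (expand s).
Proof.
move=> gE c0; elim: s => [|v s IH] /=.
  by rewrite /gp_val /mono big_seq1 !big_nil expr0 mulr1.
rewrite {1}/mono big_cons -/(mono g rho s) IH gE.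
have -> : gp_val c rho [seq t <- gp_mul (orientations v) (expand s) | clash_free t.2] =
    gp_val c rho (gp_mul (orientations v) (expand s)).
  rewrite /gp_val big_filter [RHS](bigID (fun t => clash_free t.2)) /=.
  rewrite [X in _ + X]big1_seq ?addr0 // => -[b [|o s']] //= /andP[].
  by rewrite negbK => /c0 -> _; rewrite mulr0.
rewrite gp_val_mul; congr (_ * _); case: v => [[A B] C] /=.
by rewrite /gp_val /mono !big_cons !big_nil /= expr0 expr1; ring.
Qed.

End GraphPolynomials.

(** * Contraction of v-edges to traces *)

Section Contraction.
Context {R : realType} {m r : nat} (j : {linear 'cV[R]_r -> 'M[R]_m}).
Hypothesis soj : so_valued j.
Variable Z : 'I_r -> 'cV[R]_r.
Local Notation V := 'cV[R]_(m + r).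
Implicit Types (rho : nat -> V) (x y z : V).

Definition adapted_frame (k : 'I_(m + r)) : V :=
  match fintype.split k with
  | inl i => col_mx (delta_mx i 0) 0
  | inr a => col_mx 0 (Z a)
  end.

Lemma adapted_frame_lshift i : adapted_frame (lshift r i) = col_mx (delta_mx i 0) 0.
Proof. by rewrite /adapted_frame -[lshift r i]/(unsplit (inl i)) unsplitK. Qed.

Lemma adapted_frame_rshift a : adapted_frame (rshift m a) = col_mx 0 (Z a).
Proof. by rewrite /adapted_frame -[rshift m a]/(unsplit (inr a)) unsplitK. Qed.

Local Notation w := adapted_frame.

(** The v-components of the adapted basis resolve the identity of v; this is what
    turns a sum over a v-label into a matrix product. *)
Lemma sum_usubmx_adapted :
  \sum_k usubmx (w k) *m (usubmx (w k))^T = 1%:M.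
Proof.
rewrite big_split_ord /= [X in _ + X]big1 => [|a _]; last first.
  by rewrite adapted_frame_rshift col_mxKu mul0mx.
rewrite addr0; apply/matrixP => i k; rewrite summxE !mxE (bigD1 i) //= big1 => [|l nli].
  by rewrite adapted_frame_lshift col_mxKu !mxE big_ord1 !mxE !eqxx mul1r addr0 andbT eq_sym.
by rewrite adapted_frame_lshift col_mxKu !mxE big_ord1 !mxE [i == l]eq_sym (negbTE nli) mul0r.
Qed.

Definition j_form x y z : R :=
  ((usubmx y)^T *m j (dsubmx x) *m usubmx z) 0 0.

Definition word_mx rho (u : seq nat) : 'M[R]_m :=
  \big[mulmx/1%:M]_(k <- u) j (dsubmx (rho k)).

Definition strand_val rho (f : strand) : R :=
  ((usubmx (rho f.1.2))^T *m word_mx rho f.1.1 *m usubmx (rho f.2)) 0 0.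

Definition state_val (st : bool * seq (seq nat) * seq strand) rho : R :=
  (-1) ^+ st.1.1 * (\prod_(u <- st.1.2) \tr (word_mx rho u)) *
  \prod_(f <- st.2) strand_val rho f.

Lemma word_mx_cons rho k u : word_mx rho (k :: u) = j (dsubmx (rho k)) *m word_mx rho u.
Proof. exact: big_cons. Qed.

Lemma word_mx_cat rho u v : word_mx rho (u ++ v) = word_mx rho u *m word_mx rho v.
Proof.
elim: u => [|k u IH]; first by rewrite /word_mx big_nil mul1mx.
by rewrite cat_cons !word_mx_cons IH mulmxA.
Qed.

Lemma word_mx1 rho k : word_mx rho [:: k] = j (dsubmx (rho k)).
Proof. by rewrite word_mx_cons /word_mx big_nil mulmx1. Qed.

Lemma word_mx_update rho e x u : e \notin u -> word_mx (update rho e x) u = word_mx rho u.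
Proof.
move=> neu; apply: eq_big_seq => k ku.
by rewrite /update; case: eqP => // ke; rewrite -ke ku in neu.
Qed.

Lemma word_mx_tr rho u : (word_mx rho u)^T = (-1) ^+ odd (size u) *: word_mx rho (rev u).
Proof.
elim: u => [|k u IH]; first by rewrite /word_mx /rev !big_nil trmx1 scale1r.
rewrite word_mx_cons trmx_mul IH soj rev_cons -cats1 word_mx_cat word_mx1 /=.
by rewrite mulmxN -scalemxAl signrN scaleNr.
Qed.

Lemma strand_val_flip rho u (x y : nat) :
  strand_val rho (u, x, y) = (-1) ^+ odd (size u) * strand_val rho (rev u, y, x).
Proof.
rewrite /strand_val /=.
set B := _ *m _; have -> : B 0 0 = B^T 0 0 by rewrite [RHS]mxE.
by rewrite /B !trmx_mul trmxK word_mx_tr mulmxA -scalemxAr -scalemxAl mxE.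
Qed.

Lemma strand_val_end_at rho (y : nat) f :
  strand_val rho f = (-1) ^+ (end_at y f).1 * strand_val rho (end_at y f).2.
Proof.
case: f => [[u a] b] /=; case: ifP => _ /=; first by rewrite expr0 mul1r.
exact: strand_val_flip.
Qed.

Lemma strand_val_update rho e x f : e \notin f.1.1 -> e != f.1.2 -> e != f.2 ->
  strand_val (update rho e x) f = strand_val rho f.
Proof.
move=> nu na nb; rewrite /strand_val word_mx_update // /update.
by rewrite eq_sym (negbTE na) eq_sym (negbTE nb).
Qed.

Lemma sum_strand_loop rho (y : nat) u : y \notin u ->
  \sum_i strand_val (update rho y (w i)) (u, y, y) = \tr (word_mx rho u).
Proof.
move=> nyu; rewrite /strand_val /=.
under eq_bigr => i _ do rewrite word_mx_update // /update eqxx -trace_mx11 -mulmxA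
  mxtrace_mulC -mulmxA.
by rewrite -raddf_sum -mulmx_sumr sum_usubmx_adapted mulmx1.
Qed.

Lemma sum_strand_join rho (y : nat) u v (x z : nat) :
  y \notin u -> y \notin v -> x != y -> z != y ->
  \sum_i strand_val (update rho y (w i)) (u, x, y) * strand_val (update rho y (w i)) (v, y, z) =
  strand_val rho (u ++ v, x, z).
Proof.
move=> nyu nyv nxy nzy; rewrite /strand_val /=.
transitivity (\sum_i ((usubmx (rho x))^T *m word_mx rho u *m
    (usubmx (w i) *m (usubmx (w i))^T) *m (word_mx rho v *m usubmx (rho z))) 0 0).
  apply: eq_bigr => i _; rewrite !word_mx_update // /update eqxx (negbTE nxy) (negbTE nzy).
  set a := _^T; set b := usubmx (w i); set c := usubmx (rho z).
  transitivity ((a *m word_mx rho u *m b *m (b^T *m word_mx rho v *m c)) 0 0).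
    by rewrite [RHS]mxE big_ord1.
  by rewrite !mulmxA.
rewrite -summxE -mulmx_suml -mulmx_sumr sum_usubmx_adapted mulmx1.
by rewrite word_mx_cat !mulmxA.
Qed.

Lemma prod_strand_update rho e x (fs : seq strand) :
  all (fun f : strand => [&& e \notin f.1.1, f.1.2 != e & f.2 != e]) fs ->
  \prod_(f <- fs) strand_val (update rho e x) f = \prod_(f <- fs) strand_val rho f.
Proof.
move=> /allP ok; apply: eq_big_seq => f /ok /and3P[? ? ?].
by rewrite strand_val_update // eq_sym.
Qed.

(** Everything that does not contain y is constant in the sum. What is left is
    [sum_strand_loop] if one strand meets y, and [sum_strand_join] if two do. *)
Lemma contract_edge_val (y : nat) st st' rho : contract_edge y st = Some st' ->
  \sum_i state_val st (update rho y (w i)) = state_val st' rho.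
Proof.
case: st => [[s l] fs]; rewrite /contract_edge.
case: ifP => // /negbT; rewrite negb_or => /andP[nyl /hasPn nyfs].
set at_y := (fun f : strand => _).
set rest := [seq f <- fs | ~~ _]; set inc := [seq f <- fs | _].
have restP x : \prod_(f <- rest) strand_val (update rho y x) f =
    \prod_(f <- rest) strand_val rho f.
  apply: prod_strand_update; apply/allP => f; rewrite mem_filter => /andP[].
  by rewrite negb_or => /andP[-> ->] /nyfs ->.
have loopsP x : \prod_(u <- l) \tr (word_mx (update rho y x) u) =
    \prod_(u <- l) \tr (word_mx rho u).
  apply: eq_big_seq => u ul; rewrite word_mx_update //.
  by apply: contra nyl => yu; apply/flattenP; exists u.
have stE x : state_val (s, l, fs) (update rho y x) =
    (-1) ^+ s * (\prod_(u <- l) \tr (word_mx rho u)) *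
    ((\prod_(f <- inc) strand_val (update rho y x) f) *
     \prod_(f <- rest) strand_val rho f).
  rewrite /state_val /= loopsP; congr (_ * _).
  by rewrite (bigID at_y) /= -big_filter; congr (_ * _); rewrite -big_filter restP.
under eq_bigr => i _ do rewrite stE.
rewrite -mulr_sumr -mulr_suml {stE}.
have sub_at f : f \in inc -> at_y f /\ y \notin f.1.1.
  by rewrite mem_filter => /andP[? /nyfs].
case: inc sub_at => [//|f1 [|f2 [|//]]] sub_at.
  have [] := sub_at f1 (mem_head _ _).
  case: f1 {sub_at} => [[u a] b]; rewrite /at_y /= => aby nyu.
  case: (eqVneq a b) aby => // <-; rewrite orbb => /eqP -> [<-].
  rewrite (_ : \sum_i _ = \tr (word_mx rho u)); last first.
    by rewrite -(sum_strand_loop rho nyu); apply: eq_bigr => i _; rewrite big_seq1.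
  by rewrite /state_val /= big_cons; ring.
have [_ nyu1] := sub_at f1 (mem_head _ _).
have [_ nyu2] : at_y f2 /\ y \notin f2.1.1 by apply: sub_at; rewrite !inE eqxx orbT.
have ny f : y \notin f.1.1 -> y \notin (end_at y f).2.1.1.
  by case: f => [[u a] b] /=; case: ifP => //= _; rewrite mem_rev.
have {ny nyu1 nyu2} := (ny _ nyu1, ny _ nyu2).
have endE f rho' := strand_val_end_at rho' y f.
case: (end_at y f1) (endE f1) => s1 [[w1 x] y1] E1.
case: (end_at y f2) (endE f2) => s2 [[w2 z] y2] E2 /= [nyw1 nyw2].
case: ifP => // /and4P[nxy nzy /eqP y1y /eqP y2y] [<-]; subst y1 y2.
rewrite (_ : \sum_i _ = (-1) ^+ s1 * (-1) ^+ s2 * (-1) ^+ odd (size w2) *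
    strand_val rho (w1 ++ rev w2, x, z)); last first.
  rewrite -(sum_strand_join rho nyw1 _ nxy nzy) ?mem_rev // mulr_sumr.
  apply: eq_bigr => i _.
  by rewrite big_cons big_seq1 E1 E2 /= (strand_val_flip _ w2); ring.
by rewrite /state_val /= big_cons !signr_addb; ring.
Qed.

Lemma contract_val ys st st' rho : contract ys st = Some st' ->
  isum w ys (state_val st) rho = state_val st' rho.
Proof.
elim: ys st' rho => [|y ys IH] st' rho /=; first by case=> ->.
case E: (contract ys st) => [st1|] //= /contract_edge_val <-.
by apply: eq_bigr => i _; rewrite (IH st1).
Qed.

Lemma word_mx_eq0 rho e u : e \in u -> dsubmx (rho e) = 0 -> word_mx rho u = 0.
Proof.
move=> + de; elim: u => [//|k u IH]; rewrite word_mx_cons inE => /predU1P[<-|/IH ->].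
  by rewrite de linear0 mul0mx.
by rewrite mulmx0.
Qed.

Lemma prod_word_eq0 rho e (l : seq (seq nat)) : e \in flatten l -> dsubmx (rho e) = 0 ->
  \prod_(u <- l) \tr (word_mx rho u) = 0.
Proof.
move=> /flattenP[u ul eu] de; rewrite (big_rem u) //= (word_mx_eq0 eu) //.
by rewrite mxtrace0 mul0r.
Qed.

Lemma sum_ffun3 (G : 'I_r -> 'I_r -> 'I_r -> R) :
  \sum_a \sum_b \sum_c G a b c =
  \sum_(f : {ffun 'I_3 -> 'I_r}) G (f (inord 0)) (f (inord 1)) (f (inord 2)).
Proof.
rewrite pair_bigA pair_bigA /=.
rewrite (reindex (fun f : {ffun 'I_3 -> 'I_r} => (f (inord 0), f (inord 1), f (inord 2)))) //=.
exists (fun t => [ffun k : 'I_3 => nth t.1.1 [:: t.1.1; t.1.2; t.2] k]) => [f _|[[a b] c] _] /=.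
  apply/ffunP => k; rewrite ffunE; case: k => [[|[|[|//]]]] lt3 /=;
  by congr (f _); apply/val_inj; rewrite /= inordK.
by rewrite !ffunE !inordK.
Qed.

Lemma is_nat_pattern_mem l : is_nat_pattern l -> flatten l =i [:: 0; 1; 2]%N.
Proof.
move=> /andP[_ /perm_mem lE] k; rewrite lE !inE.
by case: eqP => //; case: eqP => //; case: eqP.
Qed.

(** Every label occurs in some word, so a basis vector of v at any label makes the
    product vanish; the sums over the adapted basis shrink to sums over Z. *)
Lemma sum_frame_trace l : is_nat_pattern l ->
  \sum_a \sum_b \sum_c \prod_(u <- l) \tr (word_mx (nth 0 [:: w a; w b; w c]) u) =
  trace_invariant Z j [seq [seq inord k : 'I_3 | k <- u] | u <- l].
Proof.
move=> /is_nat_pattern_mem lE.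
have vanish (e : nat) (x y z : V) : (e < 3)%N -> dsubmx (nth 0 [:: x; y; z] e) = 0 ->
    \prod_(u <- l) \tr (word_mx (nth 0 [:: x; y; z]) u) = 0.
  move=> lt3 de; apply: (prod_word_eq0 (e := e)) => //.
  by rewrite lE; case: e lt3 {de} => [|[|[|]]].
have restrict (F : 'I_(m + r) -> R) : (forall i, F (lshift r i) = 0) ->
    \sum_k F k = \sum_a F (rshift m a).
  by move=> F0; rewrite big_split_ord /= big1 ?add0r.
have d0 i : dsubmx (w (lshift r i)) = 0 by rewrite adapted_frame_lshift col_mxKd.
rewrite restrict => [|i]; last first.
  by apply: big1 => b _; apply: big1 => c _; apply: (vanish 0%N _ _ _ isT (d0 _)).
transitivity (\sum_a \sum_b \sum_c \prod_(u <- l) \tr (word_mx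
    (nth 0 [:: w (rshift m a); w (rshift m b); w (rshift m c)]) u)).
  apply: eq_bigr => a _; rewrite restrict => [|i].
    apply: eq_bigr => b _; rewrite restrict // => i.
    exact: (vanish 2%N _ _ _ isT (d0 _)).
  by apply: big1 => c _; apply: (vanish 1%N _ _ _ isT (d0 _)).
rewrite sum_ffun3; apply: eq_bigr => f _; rewrite big_map.
apply: eq_big_seq => u ul; rewrite big_map; congr (\tr _).
apply: eq_big_seq => k ku; congr (j _).
have: k \in flatten l by apply/flattenP; exists u.
by rewrite lE !inE => /or3P[] /eqP -> /=; rewrite adapted_frame_rshift col_mxKd.
Qed.

Lemma contract_graph_val es s rho sg l : uniq es ->
  contract_graph es s = Some (sg, l) -> is_nat_pattern l ->
  isum w es (fun rho => mono j_form rho s) rho =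
  (-1) ^+ sg * trace_invariant Z j [seq [seq inord k : 'I_3 | k <- u] | u <- l].
Proof.
move=> ues; rewrite /contract_graph; cbv zeta.
set vs := [seq e <- es | e \notin _]; set zs := [seq e <- es | e \in _].
set st0 := (false, _, _).
case E: (contract vs st0) => [[[sg' l'] [|//]]|//]; case: eqP => // sz [<- <-] lpat.
rewrite (isum_split w (fun e => e \in [seq v.1.1 | v <- s])) // -/zs -/vs.
rewrite (@eq_isum _ _ _ w _ _ (state_val (sg', l', [::]))); last first.
  move=> rho'; rewrite -(contract_val rho' E); apply: eq_isum => rho''.
  rewrite /state_val /= big_nil expr0 mul1r mul1r big_map.
  by apply: eq_bigr => v _; rewrite /strand_val /= word_mx1.
have uzs : uniq zs by apply: filter_uniq.
rewrite -(sum_frame_trace lpat).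
case: zs sz lpat uzs => [|e [|f [|g [|]]]] //= _ lpat /and3P[nef nfg _].
rewrite mulr_sumr; apply: eq_bigr => a _; rewrite mulr_sumr; apply: eq_bigr => b _.
rewrite mulr_sumr; apply: eq_bigr => c _; rewrite /state_val /= big_nil mulr1 big_map.
congr (_ * _); apply: eq_big_seq => u ul; congr (\tr _); rewrite /word_mx big_map.
apply: eq_big_seq => k ku; congr (j (dsubmx _)).
have : index k [:: e; f; g] \in [:: 0; 1; 2]%N.
  rewrite -(is_nat_pattern_mem lpat); apply/flattenP.
  exists [seq index k [:: e; f; g] | k <- u]; first exact: map_f.
  exact: (map_f (fun k => index k [:: e; f; g])).
rewrite /= /update ![_ == k]eq_sym; move: nef; rewrite !inE negb_or => /andP[nef neg].
case: (eqVneq k e) => [->|nke]; first by rewrite (negbTE nef) (negbTE neg).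
case: (eqVneq k f) => [->|nkf]; first by move: nfg; rewrite inE => /negbTE ->.
by case: (eqVneq k g).
Qed.

End Contraction.

(** * Soundness of the reduction *)

Section Reduction.
Context {R : realType} {m r : nat} (j : {linear 'cV[R]_r -> 'M[R]_m}).
Hypothesis soj : so_valued j.
Variable Z : 'I_r -> 'cV[R]_r.
Local Notation V := 'cV[R]_(m + r).
Local Notation w := (adapted_frame Z).
Implicit Types (rho : nat -> V) (u : seq nat) (l : seq (seq nat)).

Lemma trace_word_rot rho k u :
  \tr (word_mx j rho (k :: u)) = \tr (word_mx j rho (rcons u k)).
Proof. by rewrite word_mx_cons mxtrace_mulC -cats1 word_mx_cat word_mx1. Qed.

Lemma trace_word_rev rho u :
  \tr (word_mx j rho u) = (-1) ^+ odd (size u) * \tr (word_mx j rho (rev u)).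
Proof. by rewrite -mxtrace_tr word_mx_tr // mxtraceZ. Qed.

Lemma trace_word1 rho k : \tr (word_mx j rho [:: k]) = 0.
Proof. have := trace_word_rev rho [:: k]; rewrite /= expr1; lra. Qed.

Lemma trace_word3_rev rho a b c :
  \tr (word_mx j rho [:: a; b; c]) = - \tr (word_mx j rho [:: c; b; a]).
Proof. by rewrite trace_word_rev /= expr1 mulN1r. Qed.

(** The skew maps give Tr(abc) = - Tr(cba), and the trace is cyclic. Hence the six
    permutations of 012 agree up to sign, and Tr(aab) = - Tr(baa) = - Tr(aab)
    vanishes. *)
Lemma trace_word_triangle rho u : size u = 3 -> all (fun k => k < 3)%N u ->
  \tr (word_mx j rho u) =
  if triangle_sign u is Some s then (-1) ^+ s * \tr (word_mx j rho [:: 0; 1; 2]) else 0.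
Proof.
have rot a b c : \tr (word_mx j rho [:: a; b; c]) = \tr (word_mx j rho [:: b; c; a]).
  exact: trace_word_rot.
have rev := trace_word3_rev rho.
have dup a b : \tr (word_mx j rho [:: a; a; b]) = 0.
  have := rev a a b; rewrite (rot b a a); lra.
case: u => [|a [|b [|c []]]] //= _ /and4P[].
case: a => [|[|[|//]]] _; case: b => [|[|[|//]]] _; case: c => [|[|[|//]]] _ _;
rewrite /triangle_sign /= ?expr0 ?expr1 ?mul1r ?mulN1r ?dup //;
first [ by rewrite rot dup | by rewrite rot rot dup | by rewrite rot
      | by rewrite -rot | by rewrite rev | by rewrite rev rot
      | by rewrite rev -rot ].
Qed.

Definition pattern_val l : R :=
  trace_invariant Z j [seq [seq inord k : 'I_3 | k <- u] | u <- l].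

Lemma pattern_valE l : pattern_val l =
  \sum_(f : {ffun 'I_3 -> 'I_r})
    \prod_(u <- l) \tr (word_mx j (fun k => col_mx 0 (Z (f (inord k)))) u).
Proof.
apply: eq_bigr => f _; rewrite big_map; apply: eq_bigr => u _; rewrite big_map.
by congr (\tr _); apply: eq_bigr => k _; rewrite col_mxKd.
Qed.

Lemma normalize_val s l L : normalize (s, l) = Some L ->
  (-1) ^+ s * pattern_val l = \sum_(t <- L) (-1) ^+ t.1 * pattern_val t.2.
Proof.
rewrite /normalize; case: ifP => // /negbFE lpat.
case: ifP => _; first by case=> <-; rewrite big_seq1.
case: ifP => [/hasP[u ul /eqP su] [<-]|_].
  rewrite big_nil pattern_valE big1 ?mulr0 // => f _.
  rewrite (big_rem u) //=; case: u su {ul} => [|k []] // _.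
  by rewrite trace_word1 mul0r.
have lt3 : all (fun k => k < 3)%N (flatten l).
  by apply/allP => k; rewrite (is_nat_pattern_mem lpat) !inE => /or3P[] /eqP ->.
case: l lpat lt3 => [|u [|v []]] // _; rewrite /= cats0 all_cat => /andP[lu lv].
case: ifP => // /andP[/eqP su /eqP sv].
have E f := (trace_word_triangle f su lu, trace_word_triangle f sv lv).
case: (triangle_sign u) (triangle_sign v) E => [s1|] [s2|] E [<-];
    rewrite ?big_nil ?big_seq1 /= !pattern_valE.
- rewrite !mulr_sumr; apply: eq_bigr => f _.
  by rewrite !big_cons !big_nil !E !signr_addb; ring.
- by rewrite big1 ?mulr0 // => f _; rewrite !big_cons !E mul0r mulr0.
- by rewrite big1 ?mulr0 // => f _; rewrite !big_cons !E mul0r.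
- by rewrite big1 ?mulr0 // => f _; rewrite !big_cons !E mul0r.
Qed.

Definition pp_val (L : pattern_poly) : R :=
  \sum_(t <- L) (-1) ^+ t.1 * pattern_val t.2.

Lemma collect_val (A : Type) (f : A -> option pattern_poly) (s : seq A) L (F : A -> R) :
  collect f s = Some L -> (forall x L', f x = Some L' -> F x = pp_val L') ->
  \sum_(x <- s) F x = pp_val L.
Proof.
move=> + fF; elim: s L => [|x s IH] L /=.
  by case=> <-; rewrite /pp_val !big_nil.
case E: (f x) => [L1|] //=; case E2: (collect f s) => [L2|] //= [<-].
by rewrite big_cons (IH L2) // (fF _ L1) // /pp_val big_cat.
Qed.

(** Clashing products vanish because each edge carries a vector of v or of z; the
    zero assignment is pure, and labelling by the adapted basis preserves it. *)
Definition pure rho := forall e, usubmx (rho e) = 0 \/ dsubmx (rho e) = 0.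

Lemma pure_update rho e k : pure rho -> pure (update rho e (w k)).
Proof.
move=> prho f; rewrite /update; case: eqP => // _; rewrite /adapted_frame.
by case: (fintype.split k) => i; [right; rewrite col_mxKd | left; rewrite col_mxKu].
Qed.

Lemma clash_eq0 rho o s : pure rho -> clash o s -> mono (j_form j) rho (o :: s) = 0.
Proof.
move=> prho.
have mono0 v : v \in o :: s -> j_form j (rho v.1.1) (rho v.1.2) (rho v.2) = 0 ->
    mono (j_form j) rho (o :: s) = 0.
  by move=> vs v0; rewrite /mono (big_rem v) //= v0 mul0r.
have center v : dsubmx (rho v.1.1) = 0 -> j_form j (rho v.1.1) (rho v.1.2) (rho v.2) = 0.
  by move=> v0; rewrite /j_form v0 linear0 mulmx0 mul0mx mxE.
have left_end v : usubmx (rho v.1.2) = 0 -> j_form j (rho v.1.1) (rho v.1.2) (rho v.2) = 0.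
  by move=> v0; rewrite /j_form v0 trmx0 !mul0mx mxE.
have right_end v : usubmx (rho v.2) = 0 -> j_form j (rho v.1.1) (rho v.1.2) (rho v.2) = 0.
  by move=> v0; rewrite /j_form v0 mulmx0 mxE.
have two v v' : v \in o :: s -> v' \in o :: s ->
    (v.1.1 == v'.1.2) || (v.1.1 == v'.2) -> mono (j_form j) rho (o :: s) = 0.
  move=> vs v's; case: (prho v.1.1) => [u0|d0]; last by move=> _; apply: mono0 vs (center _ d0).
  by case/orP => /eqP E; apply: mono0 v's _; [apply: left_end | apply: right_end]; rewrite -E.
move/hasP => [v vs]; rewrite orbA => /orP[]; apply: two => //; exact: mem_head.
Qed.

(** The scalar product of nabla_x y with z for left-invariant fields. *)
Definition connection_form (x y z : V) : R :=
  2^-1 * (j_form j z y x - j_form j x z y + j_form j y x z).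

(** Twice the connection form has integral coefficients; the resulting power of 2
    is divided out in [certified_combination]. *)
Lemma reduce_val es P L : uniq es -> reduce es P = Some L ->
  isum w es (fun rho => gp_val (fun x y z => 2 * connection_form x y z) rho P) (fun=> 0) =
  pp_val L.
Proof.
move=> ues redL; rewrite isum_lincomb.
apply: collect_val redL _ => -[s v] L1 /= redv.
rewrite (@eq_isum_in _ _ _ w pure _ _ (fun rho => gp_val (j_form j) rho (expand v))).
- rewrite isum_lincomb mulr_sumr; apply: collect_val redv _ => -[s2 c] L2 /=.
  case E: (contract_graph es c) => [[s3 l]|] //= nrm.
  rewrite /pp_val -(normalize_val nrm); move: nrm; rewrite /normalize.
  case: ifP => // /negbFE lpat _.
  by rewrite (contract_graph_val soj Z _ ues E) // /pattern_val !signr_addb; ring.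
- by move=> *; apply: pure_update.
- move=> rho prho; apply: gp_val_expand => [A B C|o s'].
    by rewrite /connection_form mulrA divff ?mul1r // pnatr_eq0.
  exact: clash_eq0.
- by move=> e; left; rewrite linear0.
Qed.

End Reduction.

Definition triangles : seq (seq nat) := [:: [:: 0; 1; 2]; [:: 0; 1; 2]]%N.

Definition nat_even_pattern l := is_nat_pattern l && all (fun u => ~~ odd (size u)) l.

(** What evaluation has to establish about a graph polynomial. The number of
    vertices enters because each of them contributes a factor 1/2. *)
Definition certifies (P : graph_poly) (p n : nat) : bool :=
  if reduce (iota 0 9) P is Some L then
    [&& all (fun t => size t.2 == 6) P,
        all (fun t => (t.2 == triangles) || nat_even_pattern t.2) L,
        count (pred1 (false, triangles)) L == p &
        count (pred1 (true, triangles)) L == n]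
  else false.

Lemma even_pattern_inord l : nat_even_pattern l ->
  even_pattern [seq [seq inord k : 'I_3 | k <- u] | u <- l].
Proof.
case/andP=> /andP[ne perm] ev; rewrite /even_pattern /is_pattern !all_map -map_flatten.
apply/andP; split; [apply/andP; split|].
- by apply: sub_all ne => -[].
- rewrite (perm_trans (perm_map _ perm)) //.
  suff -> : enum 'I_3 = [seq inord k | k <- [:: 0; 1; 2]%N] by [].
  by apply: (inj_map val_inj); rewrite val_enum_ord /= !inordK.
- by apply: sub_all ev => u /=; rewrite size_map.
Qed.

Lemma gp_val_double (R : realType) T (g : T -> T -> T -> R) rho P :
  all (fun t => size t.2 == 6) P ->
  gp_val (fun x y z => 2 * g x y z) rho P = 64 * gp_val g rho P.
Proof.
move=> /allP sz; rewrite /gp_val mulr_sumr; apply: eq_big_seq => t /sz /eqP st.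
rewrite mulrCA; congr (_ * _); rewrite /mono big_split /=; congr (_ * _).
by rewrite big_const_seq count_predT st /=; ring.
Qed.

(** The patterns depend on P alone, whence the universality of L: it is chosen
    before j, m and r. *)
Lemma certified_combination (R : realType) P p n : certifies P p n ->
  exists L : seq (R * seq (seq 'I_3)), even_combination L /\
  forall (m r : nat) (j : {linear 'cV[R]_r -> 'M[R]_m}) (Z : 'I_r -> 'cV[R]_r),
  so_valued j ->
  isum (adapted_frame Z) (iota 0 9) (fun rho => gp_val (connection_form j) rho P) (fun=> 0) =
  (p%:R - n%:R) / 64 * trace_invariant Z j pattern_123_123 + combination_value L Z j.
Proof.
rewrite /certifies; case E: (reduce _ P) => [L|//] /and4P[szP okL /eqP <- /eqP <-].
exists [seq (2^-1 ^+ 6 * (-1) ^+ t.1, [seq [seq inord k : 'I_3 | k <- u] | u <- t.2])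
       | t : bool * seq (seq nat) <- [seq t <- L | t.2 != triangles]].
split.
  rewrite /even_combination all_map; apply/allP => t; rewrite mem_filter => /andP[nt tL].
  by move/allP: okL => /(_ _ tL); rewrite (negbTE nt) /= => /even_pattern_inord.
move=> m r j Z soj; have := reduce_val soj Z (iota_uniq 0 9) E.
(* A one-term linear combination, so that the factor 64 leaves the sum. *)
rewrite (@eq_isum _ _ _ _ _ _
  (fun rho => \sum_(t <- [:: P]) 64 * gp_val (connection_form j) rho t)); last first.
  by move=> rho; rewrite big_seq1 gp_val_double.
rewrite isum_lincomb big_seq1 => valL.
apply: (@mulfI _ 64); first by rewrite pnatr_eq0.
rewrite valL mulrDr mulrA mulrCA divff ?mulr1 ?pnatr_eq0 //.
rewrite /combination_value big_map big_filter /pp_val.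
rewrite (bigID (fun t => t.2 == triangles)) /=; congr (_ + _); last first.
  rewrite mulr_sumr; apply: eq_bigr => t _; rewrite mulrA; congr (_ * _).
  by rewrite mulrA -[LHS]mul1r; congr (_ * _); field.
have -> : trace_invariant Z j pattern_123_123 = pattern_val j Z triangles.
  rewrite /pattern_123_123 (_ : enum 'I_3 = [seq inord k | k <- [:: 0; 1; 2]%N]) //.
  by apply: (inj_map val_inj); rewrite val_enum_ord /= !inordK.
rewrite {okL valL E}; elim: L => [|[s l] L IH] /=; first by rewrite big_nil subrr mul0r.
rewrite big_cons /= IH; case: (eqVneq l triangles) => [->|nl].
  by rewrite !xpair_eqE !eqxx !andbT; case: s; rewrite ?expr0 ?expr1 ?natrD /=; ring.
by rewrite !xpair_eqE (negbTE nl) !andbF.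
Qed.

(** * Orthonormal bases and contractions *)

Section OrthonormalBases.
Context {R : realType} {n : nat}.
Local Notation V := 'cV[R]_n.
Implicit Types (u w : 'I_n -> V) (x y : V) (f g : V -> R).

Lemma dotE x y : dot x y = (x^T *m y) 0 0.
Proof. by rewrite mxE; apply: eq_bigr => i _; rewrite mxE. Qed.

Lemma dotC x y : dot x y = dot y x.
Proof. by apply: eq_bigr => i _; rewrite mulrC. Qed.

Lemma dot_scalar x : scalar (dot x).
Proof.
move=> a y z; rewrite /dot mulr_sumr -big_split; apply: eq_bigr => i _ /=.
by rewrite !mxE; ring.
Qed.

Lemma dotDl x y z : dot (x + y) z = dot x z + dot y z.
Proof. by rewrite /dot -big_split; apply: eq_bigr => i _; rewrite mxE mulrDl. Qed.

Lemma dotZl (a : R) x y : dot (a *: x) y = a * dot x y.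
Proof. by rewrite /dot mulr_sumr; apply: eq_bigr => i _; rewrite mxE mulrA. Qed.

Lemma scalar0 f : scalar f -> f 0 = 0.
Proof. by move=> lf; have := lf (- 1) 0 0; rewrite scaler0 addr0 mulN1r addNr. Qed.

Lemma scalar_homo f : scalar f -> forall (a : R) x, f (a *: x) = a * f x.
Proof. by move=> lf a x; rewrite -[_ *: _]addr0 lf scalar0 // addr0. Qed.

Lemma dotNl x z : dot (- x) z = - dot x z.
Proof. by rewrite /dot -sumrN; apply: eq_bigr => i _; rewrite mxE mulNr. Qed.

Lemma dotBl x y z : dot (x - y) z = dot x z - dot y z.
Proof. by rewrite dotDl dotNl. Qed.

Lemma dot_delta x i : dot x (delta_mx i 0) = x i 0.
Proof.
rewrite /dot (bigD1 i) //= mxE !eqxx mulr1 big1 ?addr0 // => k nk.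
by rewrite mxE (negbTE nk) mulr0.
Qed.

Lemma dot_inj x y : (forall z, dot x z = dot y z) -> x = y.
Proof. by move=> E; apply/colP => i; rewrite -!dot_delta E. Qed.

Lemma orthonormal_expand w x : orthonormal_basis w ->
  x = \sum_i dot x (w i) *: w i.
Proof.
move=> onw; pose W : 'M[R]_n := \matrix_(a, i) w i a 0.
have WtW : W^T *m W = 1%:M.
  apply/matrixP => i k; rewrite !mxE -onw; apply: eq_bigr => a _.
  by rewrite !mxE.
rewrite -[LHS]mul1mx -(mulmx1C WtW) -mulmxA.
apply/colP => a; rewrite mxE summxE; apply: eq_bigr => i _.
rewrite !mxE mulrC; congr (_ * _); apply: eq_bigr => b _.
by rewrite !mxE mulrC.
Qed.

Lemma scalar_expand w f x : orthonormal_basis w -> scalar f ->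
  f x = \sum_i dot x (w i) * f (w i).
Proof.
move=> onw lf; rewrite {1}(orthonormal_expand x onw).
elim/big_rec2: _ => [|i a y _ <-]; [exact: scalar0 | exact: lf].
Qed.

(** Both sides are the scalar product of the vectors representing f and g. *)
Lemma sum_scalar2 u w f g : orthonormal_basis u -> orthonormal_basis w ->
  scalar f -> scalar g -> \sum_i f (u i) * g (u i) = \sum_i f (w i) * g (w i).
Proof.
move=> onu onw lf lg.
under eq_bigr => i _ do rewrite (scalar_expand (u i) onw lf) mulr_suml.
rewrite exchange_big; apply: eq_bigr => k _ /=.
rewrite [in RHS](scalar_expand (w k) onu lg) mulr_sumr.
by apply: eq_bigr => i _; rewrite dotC; ring.
Qed.

Definition quadratic_at (e : nat) (F : (nat -> V) -> R) := forall rho,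
  exists f g, [/\ scalar f, scalar g & forall x, F (update rho e x) = f x * g x].

(** Every label can be summed innermost, where [sum_scalar2] applies. *)
Lemma isum_change_basis u w es F rho :
  orthonormal_basis u -> orthonormal_basis w -> uniq es ->
  (forall e, e \in es -> quadratic_at e F) -> isum u es F rho = isum w es F rho.
Proof.
move=> onu onw; elim: es rho => [//|e es IH] rho /= /andP[nes ues] quad.
have quad_es k : k \in es -> quadratic_at k F by move=> kes; apply: quad; rewrite inE kes orbT.
under eq_bigr => i _ do rewrite IH //.
rewrite !isum_exchange //; apply: eq_isum => rho'.
have [f [g [lf lg E]]] := quad e (mem_head _ _) rho'.
under eq_bigr do rewrite E; under [in RHS]eq_bigr do rewrite E.
exact: sum_scalar2.
Qed.

Lemma scalarMl f (c : R) : scalar f -> scalar (fun x => c * f x).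
Proof. by move=> lf a x y; rewrite lf; ring. Qed.

Lemma scalarMr f (c : R) : scalar f -> scalar (fun x => f x * c).
Proof. by move=> lf a x y; rewrite lf; ring. Qed.

End OrthonormalBases.

Section MultilinearContractions.
Context {R : realType} {n : nat}.
Local Notation V := 'cV[R]_n.
Variables (u w : 'I_n -> V).
Hypotheses (onu : orthonormal_basis u) (onw : orthonormal_basis w).

(** In the three contractions below each index occurs in exactly two slots, so
    that the summand is a product of two linear functions of that index. *)

Section FourTensor.
Variable T : V -> V -> V -> V -> R.
Hypothesis T1 : forall y z t, scalar (fun x => T x y z t).
Hypothesis T2 : forall x z t, scalar (fun y => T x y z t).
Hypothesis T3 : forall x y t, scalar (fun z => T x y z t).
Hypothesis T4 : forall x y z, scalar (fun t => T x y z t).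

Local Ltac lin := repeat first [exact: T1 | exact: T2 | exact: T3 | exact: T4
      | apply: scalarMr | apply: scalarMl].
Local Ltac quad f g := exists f, g; split; [by lin | by lin |
  by move=> x; rewrite /update /= 1?mulrAC].

Lemma hat_change_basis :
  \sum_i \sum_j \sum_k \sum_l \sum_a \sum_b
    T (u i) (u j) (u k) (u l) * T (u k) (u l) (u a) (u b)
    * T (u a) (u b) (u i) (u j) =
  isum w (iota 0 6) (fun rho => T (rho 0) (rho 1) (rho 2) (rho 3) *
  T (rho 2) (rho 3) (rho 4) (rho 5) * T (rho 4) (rho 5) (rho 0) (rho 1)) (fun=> 0).
Proof.
rewrite -(isum_change_basis _ onu onw) ?iota_uniq // => e.
rewrite mem_iota => /andP[_]; case: e => [|[|[|[|[|[|//]]]]]] _ rho.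
- quad (fun x => T x (rho 1) (rho 2) (rho 3) * T (rho 2) (rho 3) (rho 4) (rho 5))
       (fun x => T (rho 4) (rho 5) x (rho 1)).
- quad (fun x => T (rho 0) x (rho 2) (rho 3) * T (rho 2) (rho 3) (rho 4) (rho 5))
       (fun x => T (rho 4) (rho 5) (rho 0) x).
- quad (fun x => T (rho 0) (rho 1) x (rho 3) * T (rho 4) (rho 5) (rho 0) (rho 1))
       (fun x => T x (rho 3) (rho 4) (rho 5)).
- quad (fun x => T (rho 0) (rho 1) (rho 2) x * T (rho 4) (rho 5) (rho 0) (rho 1))
       (fun x => T (rho 2) x (rho 4) (rho 5)).
- quad (fun x => T (rho 0) (rho 1) (rho 2) (rho 3) * T (rho 2) (rho 3) x (rho 5))
       (fun x => T x (rho 5) (rho 0) (rho 1)).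
- quad (fun x => T (rho 0) (rho 1) (rho 2) (rho 3) * T (rho 2) (rho 3) (rho 4) x)
       (fun x => T (rho 4) x (rho 0) (rho 1)).
Qed.

Lemma ring_change_basis :
  \sum_i \sum_j \sum_k \sum_l \sum_a \sum_b
    T (u i) (u k) (u j) (u l) * T (u k) (u a) (u l) (u b)
    * T (u a) (u i) (u b) (u j) =
  isum w (iota 0 6) (fun rho => T (rho 0) (rho 2) (rho 1) (rho 3) *
  T (rho 2) (rho 4) (rho 3) (rho 5) * T (rho 4) (rho 0) (rho 5) (rho 1)) (fun=> 0).
Proof.
rewrite -(isum_change_basis _ onu onw) ?iota_uniq // => e.
rewrite mem_iota => /andP[_]; case: e => [|[|[|[|[|[|//]]]]]] _ rho.
- quad (fun x => T x (rho 2) (rho 1) (rho 3) * T (rho 2) (rho 4) (rho 3) (rho 5))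
       (fun x => T (rho 4) x (rho 5) (rho 1)).
- quad (fun x => T (rho 0) (rho 2) x (rho 3) * T (rho 2) (rho 4) (rho 3) (rho 5))
       (fun x => T (rho 4) (rho 0) (rho 5) x).
- quad (fun x => T (rho 0) x (rho 1) (rho 3) * T (rho 4) (rho 0) (rho 5) (rho 1))
       (fun x => T x (rho 4) (rho 3) (rho 5)).
- quad (fun x => T (rho 0) (rho 2) (rho 1) x * T (rho 4) (rho 0) (rho 5) (rho 1))
       (fun x => T (rho 2) (rho 4) x (rho 5)).
- quad (fun x => T (rho 0) (rho 2) (rho 1) (rho 3) * T (rho 2) x (rho 3) (rho 5))
       (fun x => T x (rho 0) (rho 5) (rho 1)).
- quad (fun x => T (rho 0) (rho 2) (rho 1) (rho 3) * T (rho 2) (rho 4) (rho 3) x)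
       (fun x => T (rho 4) (rho 0) x (rho 1)).
Qed.

End FourTensor.

Lemma norm_change_basis (T : V -> V -> V -> V -> V -> R) :
  (forall x y z t, scalar (fun s => T s x y z t)) ->
  (forall s y z t, scalar (fun x => T s x y z t)) ->
  (forall s x z t, scalar (fun y => T s x y z t)) ->
  (forall s x y t, scalar (fun z => T s x y z t)) ->
  (forall s x y z, scalar (fun t => T s x y z t)) ->
  \sum_s \sum_i \sum_j \sum_k \sum_l T (u s) (u i) (u j) (u k) (u l) ^+ 2 =
  isum w (iota 0 5)
    (fun rho => T (rho 0) (rho 1) (rho 2) (rho 3) (rho 4) ^+ 2) (fun=> 0).
Proof.
move=> T1 T2 T3 T4 T5.
rewrite -(isum_change_basis _ onu onw) ?iota_uniq // => e.
rewrite mem_iota => /andP[_] lt5 rho.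
pose f x := let rho' := update rho e x in T (rho' 0) (rho' 1) (rho' 2) (rho' 3) (rho' 4).
have lin_f : scalar f.
  case: e lt5 @f => [|[|[|[|[|//]]]]] _ f; rewrite /f /update /=;
  first [exact: T1 | exact: T2 | exact: T3 | exact: T4 | exact: T5].
by exists f, f; split=> // x; rewrite expr2.
Qed.

End MultilinearContractions.

(** * Curvature contractions as graphs *)

(** The component R_{abcd} in terms of the connection form; e is the inner edge
    coming from the composition of two covariant derivatives. *)
Definition curv_graph (a b c d e : nat) : graph_poly :=
  [:: (false, [:: (a, b, e); (e, c, d)]); (true, [:: (b, a, e); (e, c, d)]);
      (true, [:: (b, c, e); (a, e, d)]); (false, [:: (a, c, e); (b, e, d)])].

(** The component of nabla_s R with indices abcd; the coefficients of R in a
    left-invariant frame are constant, so only the four correction terms occur. *)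
Definition dcurv_graph (s a b c d e f : nat) : graph_poly :=
  gp_mul (curv_graph a b c e f) [:: (false, [:: (s, e, d)])] ++
  gp_opp (gp_mul [:: (false, [:: (s, a, e)])] (curv_graph e b c d f) ++
  gp_mul [:: (false, [:: (s, b, e)])] (curv_graph a e c d f) ++
  gp_mul [:: (false, [:: (s, c, e)])] (curv_graph a b e d f)).

(** Edges 0 to 5 are the indices of the contraction, and 6, 7, 8 the inner edges
    of the three curvature factors. *)
Definition hat_graph :=
  gp_mul (gp_mul (curv_graph 0 1 2 3 6) (curv_graph 2 3 4 5 7)) (curv_graph 4 5 0 1 8).

Definition ring_graph :=
  gp_mul (gp_mul (curv_graph 0 2 1 3 6) (curv_graph 2 4 3 5 7)) (curv_graph 4 0 5 1 8).

(** Edges 0 to 4 are the indices of the contraction; 5, 6 and 7, 8 are the inner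
    edges of the two factors. *)
Definition norm_graph :=
  gp_mul (dcurv_graph 0 1 2 3 4 5 6) (dcurv_graph 0 1 2 3 4 7 8).

(** In the three evaluations the differences 0 - 28, 12 - 29 and 16 - 112 are the
    coefficients of the triangle pattern, times 64. *)
Lemma hat_certificate : certifies hat_graph 0 28.
Proof. by vm_compute. Qed.

Lemma ring_certificate : certifies ring_graph 12 29.
Proof. by vm_compute. Qed.

Lemma norm_certificate : certifies norm_graph 16 112.
Proof. by vm_compute. Qed.

Section InvariantCurvature.
Context {R : realType} {n : nat}.
Local Notation V := 'cV[R]_n.
Variable conn : V -> V -> V.
Hypothesis conn_linl : forall y, linear (conn^~ y).
Hypothesis conn_linr : forall x, linear (conn x).
Implicit Types (x y z t s : V) (u w : 'I_n -> V).

(** Curvature of a left-invariant connection evaluated on left-invariant fields.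
    The bracket is replaced by the torsion-free expression nabla_x y - nabla_y x,
    so that the connection is the only datum. *)
Definition alg_curv x y z : V :=
  conn (conn x y - conn y x) z - (conn x (conn y z) - conn y (conn x z)).

Definition alg_dcurv s x y z : V :=
  conn s (alg_curv x y z) - alg_curv (conn s x) y z - alg_curv x (conn s y) z
  - alg_curv x y (conn s z).

Local Notation gam := (fun x y z => dot (conn x y) z).
Local Notation Rf := (fun x y z t => dot (alg_curv x y z) t).
Local Notation dRf := (fun s x y z t => dot (alg_dcurv s x y z) t).

Lemma conn_scalar1 y z : scalar (fun x => gam x y z).
Proof. by move=> a x x'; rewrite conn_linl dotC dot_scalar !(dotC z). Qed.

Lemma conn_scalar2 x z : scalar (fun y => gam x y z).
Proof. by move=> a y y'; rewrite conn_linr dotC dot_scalar !(dotC z). Qed.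

Variable w : 'I_n -> V.
Hypothesis onw : orthonormal_basis w.

Lemma conn_frame1 v y z : gam v y z = \sum_e dot v (w e) * gam (w e) y z.
Proof. exact: (scalar_expand _ onw (conn_scalar1 y z)). Qed.

Lemma conn_frame2 x v z : gam x v z = \sum_e dot v (w e) * gam x (w e) z.
Proof. exact: (scalar_expand _ onw (conn_scalar2 x z)). Qed.

Definition curv_term x y z t e : R :=
  gam x y e * gam e z t - gam y x e * gam e z t - gam y z e * gam x e t
  + gam x z e * gam y e t.

Lemma alg_curv_frame x y z t : Rf x y z t = \sum_e curv_term x y z t (w e).
Proof.
rewrite /alg_curv !dotBl conn_frame1 (conn_frame2 x) (conn_frame2 y).
rewrite -!sumrB; apply: eq_bigr => e _; rewrite dotBl /curv_term; ring.
Qed.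

Lemma alg_curv_scalar1 y z t : scalar (fun x => Rf x y z t).
Proof.
move=> a x x'; rewrite !alg_curv_frame mulr_sumr -big_split; apply: eq_bigr => e _ /=.
by rewrite /curv_term !(conn_scalar1 _ _ a) !(conn_scalar2 _ _ a); ring.
Qed.

Lemma alg_curv_scalar2 x z t : scalar (fun y => Rf x y z t).
Proof.
move=> a y y'; rewrite !alg_curv_frame mulr_sumr -big_split; apply: eq_bigr => e _ /=.
by rewrite /curv_term !(conn_scalar1 _ _ a) !(conn_scalar2 _ _ a); ring.
Qed.

Lemma alg_curv_scalar3 x y t : scalar (fun z => Rf x y z t).
Proof.
move=> a z z'; rewrite !alg_curv_frame mulr_sumr -big_split; apply: eq_bigr => e _ /=.
by rewrite /curv_term !(conn_scalar2 _ _ a); ring.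
Qed.

Lemma alg_curv_scalar4 x y z : scalar (fun t => Rf x y z t).
Proof. exact: dot_scalar. Qed.

Lemma alg_dcurv_frame1 s x y z t : dRf s x y z t = \sum_e (Rf x y z (w e) * gam s (w e) t
  - gam s x (w e) * Rf (w e) y z t - gam s y (w e) * Rf x (w e) z t
  - gam s z (w e) * Rf x y (w e) t).
Proof.
rewrite /alg_dcurv 3!dotBl conn_frame2 (scalar_expand _ onw (alg_curv_scalar1 y z t)).
rewrite (scalar_expand _ onw (alg_curv_scalar2 x z t)).
rewrite (scalar_expand _ onw (alg_curv_scalar3 x y t)).
by rewrite -!sumrB.
Qed.

Definition dcurv_term s x y z t e f : R :=
  curv_term x y z e f * gam s e t - gam s x e * curv_term e y z t f
  - gam s y e * curv_term x e z t f - gam s z e * curv_term x y e t f.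

Lemma alg_dcurv_scalar1 x y z t : scalar (fun s => dRf s x y z t).
Proof.
move=> a s s'; rewrite !alg_dcurv_frame1 mulr_sumr -big_split; apply: eq_bigr => e _ /=.
by rewrite !(conn_scalar1 _ _ a); ring.
Qed.

Lemma alg_dcurv_scalar2 s y z t : scalar (fun x => dRf s x y z t).
Proof.
move=> a x x'; rewrite !alg_dcurv_frame1 mulr_sumr -big_split; apply: eq_bigr => e _ /=.
by rewrite !(conn_scalar2 _ _ a) !(alg_curv_scalar1 _ _ _ a); ring.
Qed.

Lemma alg_dcurv_scalar3 s x z t : scalar (fun y => dRf s x y z t).
Proof.
move=> a y y'; rewrite !alg_dcurv_frame1 mulr_sumr -big_split; apply: eq_bigr => e _ /=.
by rewrite !(conn_scalar2 _ _ a) !(alg_curv_scalar2 _ _ _ a); ring.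
Qed.

Lemma alg_dcurv_scalar4 s x y t : scalar (fun z => dRf s x y z t).
Proof.
move=> a z z'; rewrite !alg_dcurv_frame1 mulr_sumr -big_split; apply: eq_bigr => e _ /=.
by rewrite !(conn_scalar2 _ _ a) !(alg_curv_scalar3 _ _ _ a); ring.
Qed.

Lemma alg_dcurv_scalar5 s x y z : scalar (fun t => dRf s x y z t).
Proof. exact: dot_scalar. Qed.

Lemma alg_dcurv_frame s x y z t :
  dRf s x y z t = \sum_e \sum_f dcurv_term s x y z t (w e) (w f).
Proof.
rewrite [LHS]alg_dcurv_frame1; apply: eq_bigr => e _; rewrite !alg_curv_frame.
by rewrite mulr_suml !mulr_sumr -!sumrB.
Qed.

Lemma curv_graph_val rho a b c d e :
  gp_val gam rho (curv_graph a b c d e) = curv_term (rho a) (rho b) (rho c) (rho d) (rho e).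
Proof. by rewrite /gp_val /mono !big_cons !big_nil /= /curv_term; ring. Qed.

Lemma dcurv_graph_val rho (s a b c d e f : nat) : gp_val gam rho (dcurv_graph s a b c d e f) =
  dcurv_term (rho s) (rho a) (rho b) (rho c) (rho d) (rho e) (rho f).
Proof.
rewrite /dcurv_graph gp_val_cat gp_val_opp 2!gp_val_cat !gp_val_mul !curv_graph_val.
by rewrite /gp_val /mono !big_cons !big_nil /= /dcurv_term; ring.
Qed.

Variable u : 'I_n -> V.
Hypothesis onu : orthonormal_basis u.

Lemma sum_distr3 (I : finType) (f g h : I -> R) :
  (\sum_a f a) * (\sum_b g b) * (\sum_c h c) = \sum_a \sum_b \sum_c f a * g b * h c.
Proof.
by rewrite big_distrlr /= big_distrl; apply: eq_bigr => a _; rewrite big_distrlr.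
Qed.

Lemma hat_sum :
  \sum_i \sum_j \sum_k \sum_l \sum_a \sum_b
    Rf (u i) (u j) (u k) (u l) * Rf (u k) (u l) (u a) (u b)
    * Rf (u a) (u b) (u i) (u j) =
  isum w (iota 0 9) (fun rho => gp_val gam rho hat_graph) (fun=> 0).
Proof.
pose F (rho : nat -> V) := Rf (rho 0) (rho 1) (rho 2) (rho 3) *
  Rf (rho 2) (rho 3) (rho 4) (rho 5) * Rf (rho 4) (rho 5) (rho 0) (rho 1).
transitivity (isum w (iota 0 6) F (fun=> 0)).
  exact: (hat_change_basis onu onw
    alg_curv_scalar1 alg_curv_scalar2 alg_curv_scalar3 alg_curv_scalar4).
rewrite (_ : iota 0 9 = iota 0 6 ++ iota 6 3) // isum_cat.
apply: eq_isum => rho; rewrite /F !alg_curv_frame sum_distr3.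
apply: eq_bigr => a _; apply: eq_bigr => b _; apply: eq_bigr => c _.
by rewrite /hat_graph !gp_val_mul !curv_graph_val.
Qed.

Lemma ring_sum :
  \sum_i \sum_j \sum_k \sum_l \sum_a \sum_b
    Rf (u i) (u k) (u j) (u l) * Rf (u k) (u a) (u l) (u b)
    * Rf (u a) (u i) (u b) (u j) =
  isum w (iota 0 9) (fun rho => gp_val gam rho ring_graph) (fun=> 0).
Proof.
pose F (rho : nat -> V) := Rf (rho 0) (rho 2) (rho 1) (rho 3) *
  Rf (rho 2) (rho 4) (rho 3) (rho 5) * Rf (rho 4) (rho 0) (rho 5) (rho 1).
transitivity (isum w (iota 0 6) F (fun=> 0)).
  exact: (ring_change_basis onu onw
    alg_curv_scalar1 alg_curv_scalar2 alg_curv_scalar3 alg_curv_scalar4).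
rewrite (_ : iota 0 9 = iota 0 6 ++ iota 6 3) // isum_cat.
apply: eq_isum => rho; rewrite /F !alg_curv_frame sum_distr3.
apply: eq_bigr => a _; apply: eq_bigr => b _; apply: eq_bigr => c _.
by rewrite /ring_graph !gp_val_mul !curv_graph_val.
Qed.

Lemma norm_sum :
  \sum_s \sum_i \sum_j \sum_k \sum_l
    dRf (u s) (u i) (u j) (u k) (u l) ^+ 2 =
  isum w (iota 0 9) (fun rho => gp_val gam rho norm_graph) (fun=> 0).
Proof.
pose F (rho : nat -> V) := dRf (rho 0) (rho 1) (rho 2) (rho 3) (rho 4) ^+ 2.
transitivity (isum w (iota 0 5) F (fun=> 0)).
  exact: (norm_change_basis onu onw alg_dcurv_scalar1 alg_dcurv_scalar2
    alg_dcurv_scalar3 alg_dcurv_scalar4 alg_dcurv_scalar5).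
rewrite (_ : iota 0 9 = iota 0 5 ++ iota 5 4) // isum_cat.
apply: eq_isum => rho; rewrite /F expr2 {1}alg_dcurv_frame alg_dcurv_frame big_distrl /=.
apply: eq_bigr => a _; rewrite big_distrl; apply: eq_bigr => b _.
rewrite big_distrr; apply: eq_bigr => c _; rewrite big_distrr; apply: eq_bigr => d _.
by rewrite /norm_graph gp_val_mul !dcurv_graph_val.
Qed.

End InvariantCurvature.

(** * Smooth functions *)

Section SmoothFunctions.
Context {R : realType} {n : nat}.
Local Notation E := 'cV[R]_n.
Implicit Types (f g : E -> R) (x y u v : E).

Lemma is_Ck_pred k f : is_Ck k.+1 f -> is_Ck k f.
Proof.
elim: k f => [|k IH] f /=; first by case.
by case=> cf Df; split=> // v; have [dv Dv] := Df v; split=> //; apply: IH.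
Qed.

Lemma smooth_continuous f : smooth f -> continuous f.
Proof. by move/(_ 0%N). Qed.

Lemma smooth_derivable f x v : smooth f -> derivable f x v.
Proof. by move/(_ 1%N) => [_ /(_ v)[]]. Qed.

Lemma smooth_derive f v : smooth f -> smooth ('D_v f).
Proof. by move=> sf k; have [_ /(_ v)[]] := sf k.+1. Qed.

Lemma smooth_cst (c : R) : smooth (cst c : E -> R).
Proof.
move=> k; elim: k c => [|k IH] c /=; first by move=> x; apply: cst_continuous.
split=> [x|v]; first exact: cst_continuous.
split=> [x|]; first exact: derivable_cst.
rewrite (_ : 'D_v _ = cst 0); first exact: IH.
by apply/funext => x; rewrite derive_cst.
Qed.

Lemma continuous_addf f g : continuous f -> continuous g -> continuous (fun x => f x + g x).
Proof. by move=> cf cg x; exact: (continuousD (cf x) (cg x)). Qed.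

Lemma continuous_mulf f g : continuous f -> continuous g -> continuous (fun x => f x * g x).
Proof. by move=> cf cg x; exact: (continuousM (cf x) (cg x)). Qed.

Lemma is_CkD k f g : is_Ck k f -> is_Ck k g -> is_Ck k (fun x => f x + g x).
Proof.
elim: k f g => [|k IH] f g /=; first exact: continuous_addf.
move=> [cf Df] [cg Dg]; split=> [|v]; first exact: continuous_addf.
have [df Dfv] := Df v; have [dg Dgv] := Dg v; split=> [x|].
  exact: (derivableD (df x) (dg x)).
rewrite (_ : 'D_v _ = fun x => 'D_v f x + 'D_v g x); first by apply: IH.
by apply/funext => x; rewrite -(deriveD (df x) (dg x)).
Qed.

Lemma smoothD f g : smooth f -> smooth g -> smooth (fun x => f x + g x).
Proof. by move=> sf sg k; apply: is_CkD. Qed.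

Lemma is_CkM k f g : is_Ck k f -> is_Ck k g -> is_Ck k (fun x => f x * g x).
Proof.
elim: k f g => [|k IH] f g; first exact: continuous_mulf.
move=> fk gk; have [/= [cf Df] [cg Dg]] := (fk, gk).
split=> [|v]; first exact: continuous_mulf.
have [df Dfv] := Df v; have [dg Dgv] := Dg v; split=> [x|].
  exact: (derivableM (df x) (dg x)).
rewrite (_ : 'D_v _ = fun x => f x * 'D_v g x + g x * 'D_v f x).
  by apply: is_CkD; apply: IH => //; apply: is_Ck_pred.
by apply/funext => x; rewrite -(deriveM (df x) (dg x)).
Qed.

Lemma smoothM f g : smooth f -> smooth g -> smooth (fun x => f x * g x).
Proof. by move=> sf sg k; apply: is_CkM. Qed.

Lemma smoothMl (c : R) f : smooth f -> smooth (fun x => c * f x).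
Proof. exact/smoothM/smooth_cst. Qed.

Lemma smooth_sum (I : Type) (s : seq I) (F : I -> E -> R) :
  (forall i, smooth (F i)) -> smooth (fun x => \sum_(i <- s) F i x).
Proof.
move=> sF; elim: s => [|i s IH].
  rewrite (_ : (fun x => _) = cst 0); first exact: smooth_cst.
  by apply/funext => x; rewrite big_nil.
rewrite (_ : (fun x => _) = fun x => F i x + \sum_(i <- s) F i x).
  exact: smoothD.
by apply/funext => x; rewrite big_cons.
Qed.

Lemma derive_coord i x v : is_derive x v (fun p : E => p i 0) (v i 0).
Proof.
apply: DeriveDef.
  exact/diff_derivable/differentiable_coord.
have lin : linear (fun p : E => p i 0) by move=> a p q; rewrite !mxE.
pose L := GRing.isLinear.Build _ _ _ _ _ lin.
pose c : {linear E -> R} := HB.pack (fun p : E => p i 0) L.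
rewrite deriveE; last exact: differentiable_coord.
rewrite (_ : (fun p : E => p i 0) = c) // diff_lin //.
exact: coord_continuous.
Qed.

Lemma smooth_coord i : smooth (fun p : E => p i 0).
Proof.
case=> [|k] /=; first exact: coord_continuous.
split=> [|v]; first exact: coord_continuous.
split=> [x|]; first exact/diff_derivable/differentiable_coord.
rewrite (_ : 'D_v _ = cst (v i 0)); first exact: smooth_cst.
by apply/funext => x; have [] := derive_coord i x v.
Qed.

Lemma is_derive_line f x v (s : R) : smooth f ->
  is_derive s (1 : R) (fun s : R => f (x + s *: v)) ('D_v f (x + s *: v)).
Proof.
move=> sf; have := @smooth_derivable f (x + s *: v) v sf.
rewrite /derivable => df.
have E1 : (fun h : R => h^-1 *: (((fun s : R => f (x + s *: v)) \o shift s) (h *: (1 : R)) -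
    f (x + s *: v))) = (fun h : R => h^-1 *: ((f \o shift (x + s *: v)) (h *: v) - f (x + s *: v))).
  apply/funext => h /=; congr (_ *: (f _ - _)).
  by rewrite [h *: 1]mulr1 scalerDl addrCA.
by apply: DeriveDef; rewrite /derivable /derive E1.
Qed.

(** The mean value theorem replaces Frechet differentiability in what follows:
    additivity of the derivative in its direction and the symmetry of second
    derivatives are obtained by comparing increments over small t and letting t
    tend to 0. *)
Lemma mean_value (phi dphi : R -> R) (t : R) : 0 < t ->
  (forall s : R, is_derive s (1 : R) phi (dphi s)) ->
  exists2 c, 0 <= c <= t & phi t - phi 0 = t * dphi c.
Proof.
move=> t0 dp; have cont : continuous phi.
  move=> s; apply: differentiable_continuous; apply/derivable1_diffP.
  by have [] := dp s.
have [c ct ->] := MVT_segment (ltW t0) (fun s _ => dp s) (continuous_subspaceT cont).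
by exists c; [move: ct; rewrite in_itv | rewrite subr0 mulrC].
Qed.

Lemma mean_value_line f x v (t : R) : 0 < t -> smooth f ->
  exists2 c, 0 <= c <= t & f (x + t *: v) - f x = t * 'D_v f (x + c *: v).
Proof.
move=> t0 sf; have [c ct] := mean_value t0 (fun s => is_derive_line x v s sf).
by rewrite scale0r addr0; exists c.
Qed.

(** The second difference over a small parallelogram is, by the mean value theorem
    in the direction u and then in the direction v, a value of D_v D_u f nearby.
    It is symmetric in u and v, which yields [smooth_deriveC]. *)
Lemma mean_value_square f x u v (t : R) : 0 < t -> smooth f ->
  exists a b, [/\ 0 <= a <= t, 0 <= b <= t &
    f (x + t *: u + t *: v) - f (x + t *: u) - f (x + t *: v) + f x =
    t * (t * 'D_v ('D_u f) (x + a *: u + b *: v))].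
Proof.
move=> t0 sf.
have d (s : R) : is_derive s (1 : R) (fun s : R => f (x + t *: v + s *: u) - f (x + s *: u))
    ('D_u f (x + t *: v + s *: u) - 'D_u f (x + s *: u)).
  exact: is_deriveB (is_derive_line _ _ _ sf) (is_derive_line _ _ _ sf).
have [a at_ E1] := mean_value t0 d.
have [b bt E2] := mean_value_line (x + a *: u) v t0 (smooth_derive u sf).
exists a, b; split=> //; rewrite -E2 [x + a *: u + _]addrAC -E1 !scale0r !addr0.
by rewrite [x + t *: u + _]addrAC; ring.
Qed.

Lemma smooth_close F x (e : R) : smooth F -> 0 < e ->
  exists2 d, 0 < d & forall y, `|y - x| < d -> `|F x - F y| < e.
Proof.
move=> /smooth_continuous /(_ x) /cvgrPdist_lt H /H /nbhs_ballP[d d0 dP].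
by exists d => // y xy; apply: dP; rewrite -ball_normE /= distrC.
Qed.

Lemma small_square u v (d : R) : 0 < d -> exists2 t, 0 < t & 
  forall x a b, 0 <= a <= t -> 0 <= b <= t -> `|x + a *: u + b *: v - x| < d.
Proof.
move=> d0; have K0 : 0 < `|u| + `|v| + 1 by rewrite ltr_wpDl ?addr_ge0.
exists (d / (`|u| + `|v| + 1)) => [|x a b]; first exact: divr_gt0.
move=> /andP[a0 at_] /andP[b0 bt].
rewrite -[x + _ + _]addrA [x + _ - x]addrAC subrr add0r.
rewrite (le_lt_trans (ler_normD _ _)) // !normrZ !ger0_norm //.
apply: le_lt_trans (_ : d / (`|u| + `|v| + 1) * (`|u| + `|v|) < d).
  by rewrite mulrDr lerD // ler_wpM2r.
by rewrite mulrAC ltr_pdivrMr // ltr_pM2l // ltrDl.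
Qed.

Lemma eq_of_close (a b : R) : (forall e, 0 < e -> `|a - b| <= e) -> a = b.
Proof.
move=> H; apply/eqP; rewrite -subr_eq0 -normr_le0.
by apply/ler_addgt0Pr => e /H; rewrite add0r.
Qed.

(** Walk from x to x + t u + t v directly, and along the two sides; divide both
    increments by t. *)
Lemma smooth_deriveD f x u v : smooth f -> 'D_(u + v) f x = 'D_u f x + 'D_v f x.
Proof.
move=> sf; apply: eq_of_close => e e0.
have e30 : 0 < e / 3 by lra.
have [d1 d10 D1] := smooth_close x (smooth_derive (u + v) sf) e30.
have [d2 d20 D2] := smooth_close x (smooth_derive u sf) e30.
have [d3 d30 D3] := smooth_close x (smooth_derive v sf) e30.
have m0 : 0 < Num.min d1 (Num.min d2 d3) by rewrite !lt_min d10 d20.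
  have [t t0 tP] := small_square u v m0.
have {}tP a b : 0 <= a <= t -> 0 <= b <= t ->
  [/\ `|x + a *: u + b *: v - x| < d1, `|x + a *: u + b *: v - x| < d2 &
    `|x + a *: u + b *: v - x| < d3].
  by move=> ha hb; have := tP x a b ha hb; rewrite !lt_min => /and3P.
have tt : 0 <= t <= t by rewrite ltW /=.
have z0 : 0 <= (0 : R) <= t by rewrite lexx ltW.
have [a at_ Ea] := mean_value_line x (u + v) t0 sf.
have [b bt Eb] := mean_value_line x u t0 sf.
have [c ct Ec] := mean_value_line (x + t *: u) v t0 sf.
have E1 : 'D_(u + v) f (x + a *: (u + v)) =
    'D_u f (x + b *: u) + 'D_v f (x + t *: u + c *: v).
  apply: (@mulfI _ t); first by rewrite gt_eqF.
  by rewrite mulrDr -Ea -Eb -Ec scalerDr addrA; ring.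
have [/D1 + _ _] := tP a a at_ at_; have [_ /D2 + _] := tP b 0 bt z0.
have [_ _ /D3] := tP t c tt ct.
rewrite scale0r addr0 -[x + a *: u + _]addrA -scalerDr E1.
move: ('D_(u + v) f x) ('D_u f x) ('D_v f x) ('D_u f _) ('D_v f _) => A B C B' C'.
rewrite !ltr_norml => /andP[? ?] /andP[? ?] /andP[? ?].
by rewrite ler_norml; apply/andP; lra.
Qed.

Lemma smooth_deriveZ f x (c : R) v : smooth f -> 'D_(c *: v) f x = c * 'D_v f x.
Proof.
move=> sf.
have pos k : 0 < k -> 'D_(k *: v) f x = k * 'D_v f x.
  move=> k0; apply: eq_of_close => e e0.
  have e20 : 0 < e / 2 by lra.
  have ek0 : 0 < e / 2 / k by rewrite divr_gt0.
  have [d1 d10 D1] := smooth_close x (smooth_derive (k *: v) sf) e20.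
  have [d2 d20 D2] := smooth_close x (smooth_derive v sf) ek0.
  have m0 : 0 < Num.min d1 d2 by rewrite lt_min d10.
  have [t t0 tP] := small_square (k *: v) v m0.
  have z0 : 0 <= (0 : R) <= t by rewrite lexx ltW.
  have kt0 : 0 < t * k by rewrite mulr_gt0.
  have [a at_ Ea] := mean_value_line x (k *: v) t0 sf.
  have [b /andP[b0 bt] Eb] := mean_value_line x v kt0 sf.
  have bkt : 0 <= b / k <= t by rewrite divr_ge0 ?(ltW k0) //= ler_pdivrMr.
  have E1 : 'D_(k *: v) f (x + a *: (k *: v)) = k * 'D_v f (x + b *: v).
    apply: (@mulfI _ t); first by rewrite gt_eqF.
    by rewrite -Ea mulrA -Eb scalerA.
  have := tP x a 0 at_ z0; have := tP x (b / k) 0 bkt z0.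
  rewrite !scale0r !addr0 [_ *: (k *: v)]scalerA divfK ?gt_eqF // !lt_min.
  move=> /andP[_ /D2 C2] /andP[/D1 C1 _].
  rewrite -[X in X - _](subrK ('D_(k *: v) f (x + a *: (k *: v)))) E1 -addrA -mulrBr.
  rewrite (le_trans (ler_normD _ _)) // [leRHS](splitr e) lerD //.
    by rewrite -E1 ltW.
  by rewrite normrM gtr0_norm // mulrC -ler_pdivlMr // distrC ltW.
case: (ltgtP c 0) => [c0|/pos //|->]; last by rewrite scale0r derive0 mul0r.
have := smooth_deriveD x (c *: v) ((- c) *: v) sf.
rewrite -scalerDl subrr scale0r derive0 (pos (- c)) ?oppr_gt0 //; lra.
Qed.

Lemma smooth_derive_expand f x v : smooth f ->
  'D_v f x = \sum_i v i 0 * 'D_(delta_mx i 0) f x.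
Proof.
move=> sf; rewrite {1}[v]matrix_sum_delta.
under eq_bigr => i _ do rewrite big_ord1.
by elim/big_rec2: _ => [|i a y _ <-]; rewrite ?derive0 // smooth_deriveD ?smooth_deriveZ.
Qed.

Lemma eq_of_close_values F G x : smooth F -> smooth G ->
  (forall d : R, 0 < d -> exists y z, [/\ `|y - x| < d, `|z - x| < d & F y = G z]) ->
  F x = G x.
Proof.
move=> sF sG FG; apply: eq_of_close => e e0.
have e20 : 0 < e / 2 by lra.
have [d1 d10 D1] := smooth_close x sF e20.
have [d2 d20 D2] := smooth_close x sG e20.
have m0 : 0 < Num.min d1 d2 by rewrite lt_min d10.
have [y [z []]] := FG _ m0; rewrite !lt_min => /andP[/D1 C1 _] /andP[_ /D2 C2] E1.
apply: le_trans (ler_distD (F y) _ _) _.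
by rewrite [leRHS]splitr lerD ?(ltW C1) // E1 distrC (ltW C2).
Qed.

Lemma smooth_deriveC f x u v : smooth f -> 'D_v ('D_u f) x = 'D_u ('D_v f) x.
Proof.
move=> sf; apply: (@eq_of_close_values ('D_v ('D_u f)) ('D_u ('D_v f))) => [||d d0].
- by do 2! apply: smooth_derive.
- by do 2! apply: smooth_derive.
have [t t0 tP] := small_square u v d0.
have [a [b [at_ bt Eab]]] := mean_value_square x u v t0 sf.
have [a' [b' [at' bt' Eab']]] := mean_value_square x v u t0 sf.
exists (x + a *: u + b *: v), (x + a' *: v + b' *: u); split.
- exact: tP.
- by rewrite (addrAC x); apply: tP.
- apply: (@mulfI _ t); first by rewrite gt_eqF.
  apply: (@mulfI _ t); first by rewrite gt_eqF.
  apply: (etrans (esym Eab)); apply: (etrans _ Eab').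
  by rewrite (addrAC x (t *: v)); congr (_ + _); exact: addrAC.
Qed.

End SmoothFunctions.

(** * Vector fields and tensors *)

Section VectorFields.
Context {R : realType} {n : nat}.
Local Notation E := 'cV[R]_n.
Implicit Types (f h : E -> R) (X Y Z W : E -> E).

Lemma smooth_fieldD X Y : smooth_field X -> smooth_field Y -> smooth_field (X + Y).
Proof.
move=> sX sY i; rewrite (_ : (fun p => _) = fun p => X p i 0 + Y p i 0).
  exact: smoothD.
by apply/funext => p; rewrite fctE mxE.
Qed.

Lemma smooth_fieldZ f X : smooth f -> smooth_field X -> smooth_field (fun p => f p *: X p).
Proof.
move=> sf sX i; rewrite (_ : (fun p => _) = fun p => f p * X p i 0).
  exact: smoothM.
by apply/funext => p; rewrite mxE.
Qed.

Lemma smooth_fieldN X : smooth_field X -> smooth_field (- X).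
Proof.
move=> sX; rewrite (_ : - X = fun p => (cst (-1) p : R) *: X p).
  by apply: smooth_fieldZ => //; exact: smooth_cst.
by apply/funext => p; rewrite fctE scaleN1r.
Qed.

Lemma smooth_fieldB X Y : smooth_field X -> smooth_field Y -> smooth_field (X - Y).
Proof. by move=> sX sY; apply: smooth_fieldD => //; apply: smooth_fieldN. Qed.

Lemma smooth_field_cst (v : E) : smooth_field (cst v).
Proof. by move=> i; exact: smooth_cst. Qed.

Lemma lie_derivative_expand X f p : smooth f ->
  lie_derivative X f p = \sum_i X p i 0 * 'D_(delta_mx i 0) f p.
Proof. exact: smooth_derive_expand. Qed.

Lemma smooth_lie_derivative X f : smooth_field X -> smooth f -> smooth (lie_derivative X f).
Proof.
move=> sX sf.
rewrite (_ : lie_derivative X f = fun p => \sum_i X p i 0 * 'D_(delta_mx i 0) f p).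
  by apply: smooth_sum => i; apply: smoothM => //; apply: smooth_derive.
by apply/funext => p; rewrite lie_derivative_expand.
Qed.

Lemma lie_derivative_sumM X (Y : E -> E) (h : 'I_n -> E -> R) p :
  smooth_field Y -> (forall i, smooth (h i)) ->
  lie_derivative X (fun p => \sum_i Y p i 0 * h i p) p =
  \sum_i (lie_derivative X (fun p => Y p i 0) p * h i p
          + Y p i 0 * lie_derivative X (h i) p).
Proof.
move=> sY sh; rewrite /lie_derivative.
rewrite (_ : (fun p => \sum_i Y p i 0 * h i p) =
   \sum_i ((fun p => Y p i 0) * h i)); last first.
  by apply/funext => q; rewrite fct_sumE.
rewrite derive_sum => [|i]; last first.
  by apply: derivableM; apply: smooth_derivable; [exact: sY | exact: sh].
apply: eq_bigr => i _.
rewrite deriveM; last 2 first.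
- exact: smooth_derivable (sY i).
- exact: smooth_derivable (sh i).
by rewrite addrC mulrC.
Qed.

(** The second derivatives of f cancel by symmetry; only the derivatives of the
    components of X and Y are left. *)
Lemma lie_derivative_bracket X Y f : smooth_field X -> smooth_field Y -> smooth f ->
  lie_derivative (lie_bracket X Y) f =
  fun p => lie_derivative X (lie_derivative Y f) p - lie_derivative Y (lie_derivative X f) p.
Proof.
move=> sX sY sf; apply/funext => p.
pose D i := 'D_(delta_mx i 0) f.
have sD i : smooth (D i) by apply: smooth_derive.
have second U W : smooth_field U -> smooth_field W -> lie_derivative U (lie_derivative W f) p =
    \sum_i lie_derivative U (fun q => W q i 0) p * D i p +
    \sum_i \sum_k W p i 0 * U p k 0 * 'D_(delta_mx k 0) (D i) p.
  move=> sU sW.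
  rewrite [lie_derivative W f](_ : _ = fun q => \sum_i W q i 0 * D i q); last first.
    by apply/funext => q; rewrite lie_derivative_expand.
  rewrite lie_derivative_sumM // -big_split; apply: eq_bigr => i _ /=.
  congr (_ + _); rewrite lie_derivative_expand // mulr_sumr.
  by apply: eq_bigr => k _; rewrite mulrA.
rewrite lie_derivative_expand // (second X Y) // (second Y X) //.
have -> : \sum_i \sum_k Y p i 0 * X p k 0 * 'D_(delta_mx k 0) (D i) p =
   \sum_i \sum_k X p i 0 * Y p k 0 * 'D_(delta_mx k 0) (D i) p.
  rewrite exchange_big; apply: eq_bigr => i _; apply: eq_bigr => k _ /=.
  by rewrite smooth_deriveC // [Y p k 0 * _]mulrC.
rewrite opprD addrACA subrr addr0 -sumrB; apply: eq_bigr => i _.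
by rewrite mxE mulrBl.
Qed.

(** Smoothness of the values makes tensorial maps closed under composition. *)
Record tensorial (T : (E -> E) -> E -> E) : Prop := Tensorial {
  tensorial_smooth : forall X, smooth_field X -> smooth_field (T X);
  tensorialD : forall X Y, smooth_field X -> smooth_field Y -> T (X + Y) = T X + T Y;
  tensorialZ : forall f X, smooth f -> smooth_field X ->
    T (fun p => f p *: X p) = fun p => f p *: T X p
}.

(** The constant coordinate fields form a global frame. *)
Lemma tensorial_expand T X p : tensorial T -> smooth_field X ->
  T X p = \sum_i X p i 0 *: T (cst (delta_mx i 0)) p.
Proof.
move=> tT sX.
pose c i : E -> E := cst (delta_mx i 0).
have sc i : smooth_field (c i) by exact: smooth_field_cst.
have sXc i : smooth_field (fun p => X p i 0 *: c i p) by apply: smooth_fieldZ.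
have {1}-> : X = \sum_i (fun p => X p i 0 *: c i p).
  apply/funext => q; rewrite fct_sumE {1}[X q]matrix_sum_delta.
  by apply: eq_bigr => i _; rewrite big_ord1.
pose S (s : seq 'I_n) := \sum_(i <- s) (fun p => X p i 0 *: c i p).
rewrite -/(S _).
suff H s : smooth_field (S s) /\ T (S s) p = \sum_(i <- s) X p i 0 *: T (c i) p.
  by have [_ ->] := H (index_enum 'I_n).
rewrite /S; elim: s => [|i s [IHs IH]].
  rewrite !big_nil.
  have -> : (0 : E -> E) = fun p => (cst 0 p : R) *: cst (0 : E) p.
    by apply/funext => q; rewrite scale0r.
  have s0 : smooth_field (cst (0 : E)) by exact: smooth_field_cst.
  by split; [apply: smooth_fieldZ => //; exact: smooth_cst
            | rewrite (tensorialZ tT (smooth_cst 0) s0) scale0r].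
rewrite !big_cons; split; first exact: smooth_fieldD.
by rewrite (tensorialD tT) // (tensorialZ tT) // fctE IH.
Qed.

Lemma tensorial_at T X Y p : tensorial T -> smooth_field X -> smooth_field Y ->
  X p = Y p -> T X p = T Y p.
Proof.
by move=> tT sX sY XY; rewrite (tensorial_expand _ tT sX) XY -(tensorial_expand _ tT sY).
Qed.

Lemma eq_tensorial T T' : (forall X, smooth_field X -> T X = T' X) ->
  tensorial T -> tensorial T'.
Proof.
move=> TT' tT; split=> [X sX|X Y sX sY|f X sf sX]; rewrite -!TT' //.
- exact: tensorial_smooth.
- exact: tensorialD.
- exact: smooth_fieldD.
- exact: tensorialZ.
- exact: smooth_fieldZ.
Qed.

Lemma tensorialB T T' : tensorial T -> tensorial T' -> tensorial (fun X => T X - T' X).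
Proof.
move=> tT tT'; split=> [X sX|X Y sX sY|f X sf sX].
- by apply: smooth_fieldB; apply: tensorial_smooth.
- by rewrite (tensorialD tT sX sY) (tensorialD tT' sX sY) opprD addrACA.
- rewrite (tensorialZ tT sf sX) (tensorialZ tT' sf sX).
  by apply/funext => p; rewrite !fctE scalerBr.
Qed.

Lemma tensorialN T : tensorial T -> tensorial (fun X => - T X).
Proof.
move=> tT; split=> [X sX|X Y sX sY|f X sf sX].
- by apply: smooth_fieldN; apply: tensorial_smooth.
- by rewrite (tensorialD tT sX sY) opprD.
- by rewrite (tensorialZ tT sf sX); apply/funext => p; rewrite !fctE scalerN.
Qed.

Lemma tensorial_comp T T' : tensorial T -> tensorial T' -> tensorial (T \o T').
Proof.
move=> tT tT'; split=> [X sX|X Y sX sY|f X sf sX] /=.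
- exact/(tensorial_smooth tT)/(tensorial_smooth tT').
- by rewrite (tensorialD tT' sX sY) (tensorialD tT) //; apply: (tensorial_smooth tT').
- by rewrite (tensorialZ tT' sf sX) (tensorialZ tT) //; apply: (tensorial_smooth tT').
Qed.

End VectorFields.

Section Tensoriality.
Context {R : realType} {n : nat}.
Local Notation E := 'cV[R]_n.
Variables (g : E -> E -> E -> R) (nabla : (E -> E) -> (E -> E) -> E -> E).
Hypothesis LC : is_levi_civita g nabla.
Implicit Types (f h : E -> R) (X Y Z W : E -> E).

Local Notation cov_smooth := (nabla_smooth LC).

Lemma nabla_tensorial Y : smooth_field Y -> tensorial (nabla^~ Y).
Proof.
move=> sY; split=> [X sX|X X' sX sX'|f X sf sX].
- exact: cov_smooth.
- exact: (nablaDl LC).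
- exact: (nablaZl LC).
Qed.

(** The derivatives of the coefficient f cancel between the two terms. In
    particular the covariant derivative of a tensor is again a tensor. *)
Lemma cov_commutator_tensorial T X : tensorial T -> smooth_field X ->
  tensorial (fun Y => nabla X (T Y) - T (nabla X Y)).
Proof.
move=> tT sX.
have sT Y : smooth_field Y -> smooth_field (T Y) by exact: tensorial_smooth.
split=> [Y sY|Y Z sY sZ|f Y sf sY].
- by apply: smooth_fieldB; [apply: cov_smooth => //; exact: sT | apply/sT/cov_smooth].
- have [snY snZ] := (cov_smooth sX sY, cov_smooth sX sZ).
  rewrite (tensorialD tT sY sZ) (nablaDr LC sX (sT _ sY) (sT _ sZ)) (nablaDr LC sX sY sZ).
  by rewrite (tensorialD tT snY snZ) opprD addrACA.
- have sXf : smooth (lie_derivative X f) by apply: smooth_lie_derivative.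
  have snY : smooth_field (nabla X Y) by apply: cov_smooth.
  rewrite (tensorialZ tT sf sY) (nabla_leibniz LC sf sX (sT _ sY)).
  rewrite (nabla_leibniz LC sf sX sY).
  rewrite (tensorialD tT (smooth_fieldZ sXf sY) (smooth_fieldZ sf snY)).
  rewrite (tensorialZ tT sXf sY) (tensorialZ tT sf snY); apply/funext => p; rewrite !fctE.
  by rewrite opprD addrACA subrr add0r scalerBr.
Qed.

Lemma nablaBl X Y Z : smooth_field X -> smooth_field Y -> smooth_field Z ->
  nabla (X - Y) Z = nabla X Z - nabla Y Z.
Proof.
move=> sX sY sZ; apply/eqP; rewrite eq_sym subr_eq.
by rewrite -(nablaDl LC (smooth_fieldB sX sY) sY sZ) subrK.
Qed.

Lemma lie_bracket_nabla X Y : smooth_field X -> smooth_field Y ->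
  lie_bracket X Y = nabla X Y - nabla Y X.
Proof. by move=> sX sY; rewrite (nabla_torsion_free LC). Qed.

Lemma smooth_lie_bracket X Y : smooth_field X -> smooth_field Y ->
  smooth_field (lie_bracket X Y).
Proof. by move=> sX sY; rewrite lie_bracket_nabla //; apply: smooth_fieldB; apply: cov_smooth. Qed.

(** With T = nabla_{.} Z, and since the torsion vanishes, the curvature is a sum of
    compositions of T with tensors and of the commutator of nabla_Y with T. *)
Lemma curvature_tensorial1 Y Z : smooth_field Y -> smooth_field Z ->
  tensorial (fun X => curvature nabla X Y Z).
Proof.
move=> sY sZ; have sYZ : smooth_field (nabla Y Z) by apply: cov_smooth.
have tZ := nabla_tensorial sZ.
have t1 := tensorial_comp tZ (nabla_tensorial sY).
have t2 := tensorialN (cov_commutator_tensorial tZ sY).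
apply: (eq_tensorial _ (tensorialB t1 (tensorialB (nabla_tensorial sYZ) (tensorialN t2)))).
move=> X sX /=; rewrite /curvature lie_bracket_nabla // nablaBl //; try exact: cov_smooth.
apply/funext => p; rewrite !fctE; apply/colP => i; rewrite !mxE; ring.
Qed.

Lemma curvature_antisym X Y Z : smooth_field X -> smooth_field Y -> smooth_field Z ->
  curvature nabla X Y Z = - curvature nabla Y X Z.
Proof.
move=> sX sY sZ; rewrite /curvature !lie_bracket_nabla // !nablaBl //; try exact: cov_smooth.
apply/funext => p; rewrite !fctE; apply/colP => i; rewrite !mxE; ring.
Qed.

Lemma curvature_tensorial2 X Z : smooth_field X -> smooth_field Z ->
  tensorial (fun Y => curvature nabla X Y Z).
Proof.
move=> sX sZ; apply: (eq_tensorial _ (tensorialN (curvature_tensorial1 sX sZ))).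
by move=> Y sY; rewrite [RHS]curvature_antisym.
Qed.

(** Here the second derivatives of the coefficient appear and are absorbed by
    [lie_derivative_bracket]. *)
Lemma curvature_tensorial3 X Y : smooth_field X -> smooth_field Y ->
  tensorial (curvature nabla X Y).
Proof.
move=> sX sY; have sXY := smooth_lie_bracket sX sY.
split=> [Z sZ|Z W sZ sW|f Z sf sZ]; rewrite /curvature.
- by do ?apply: smooth_fieldB; do ?apply: cov_smooth.
- rewrite !(nablaDr LC) //; try exact: cov_smooth.
  apply/funext => p; rewrite !fctE; apply/colP => i; rewrite !mxE; ring.
- have sXf : smooth (lie_derivative X f) by apply: smooth_lie_derivative.
  have sYf : smooth (lie_derivative Y f) by apply: smooth_lie_derivative.
  have snX : smooth_field (nabla X Z) by apply: cov_smooth.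
  have snY : smooth_field (nabla Y Z) by apply: cov_smooth.
  have sum_fields (a b : E -> R) (U W : E -> E) :
      (fun p => a p *: U p + b p *: W p) = (fun p => a p *: U p) + (fun p => b p *: W p) by [].
  rewrite !(nabla_leibniz LC) // !sum_fields !(nablaDr LC) //; try exact: smooth_fieldZ.
  rewrite !(nabla_leibniz LC) // lie_derivative_bracket //.
  apply/funext => p; rewrite !fctE; apply/colP => i; rewrite !mxE.
  move: (lie_derivative X f p) (lie_derivative Y f p) (lie_derivative X _ p)
    (lie_derivative Y _ p) => a b c d; ring.
Qed.

Lemma curvature_smooth X Y Z : smooth_field X -> smooth_field Y -> smooth_field Z ->
  smooth_field (curvature nabla X Y Z).
Proof. by move=> sX sY sZ; exact: (tensorial_smooth (curvature_tensorial3 sX sY) sZ). Qed.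

Lemma nabla_curvature_tensorial1 Y Z W : smooth_field Y -> smooth_field Z -> smooth_field W ->
  tensorial (fun X => nabla_curvature nabla X Y Z W).
Proof.
move=> sY sZ sW.
have t0 := nabla_tensorial (curvature_smooth sY sZ sW).
have t1 := tensorial_comp (curvature_tensorial1 sZ sW) (nabla_tensorial sY).
have t2 := tensorial_comp (curvature_tensorial2 sY sW) (nabla_tensorial sZ).
have t3 := tensorial_comp (curvature_tensorial3 sY sZ) (nabla_tensorial sW).
exact: (tensorialB (tensorialB (tensorialB t0 t1) t2) t3).
Qed.

Lemma nabla_curvature_tensorial2 X Z W : smooth_field X -> smooth_field Z -> smooth_field W ->
  tensorial (fun Y => nabla_curvature nabla X Y Z W).
Proof.
move=> sX sZ sW.
have t1 := cov_commutator_tensorial (curvature_tensorial1 sZ sW) sX.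
have t2 := curvature_tensorial1 (cov_smooth sX sZ) sW.
have t3 := curvature_tensorial1 sZ (cov_smooth sX sW).
exact: (tensorialB (tensorialB t1 t2) t3).
Qed.

Lemma nabla_curvature_tensorial3 X Y W : smooth_field X -> smooth_field Y -> smooth_field W ->
  tensorial (fun Z => nabla_curvature nabla X Y Z W).
Proof.
move=> sX sY sW.
have t1 := cov_commutator_tensorial (curvature_tensorial2 sY sW) sX.
have t2 := curvature_tensorial2 (cov_smooth sX sY) sW.
have t3 := curvature_tensorial2 sY (cov_smooth sX sW).
apply: (eq_tensorial _ (tensorialB (tensorialB t1 t2) t3)) => Z sZ.
by rewrite /nabla_curvature /= [X in X - _ = _]addrAC.
Qed.

Lemma nabla_curvature_tensorial4 X Y Z : smooth_field X -> smooth_field Y -> smooth_field Z ->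
  tensorial (nabla_curvature nabla X Y Z).
Proof.
move=> sX sY sZ.
have t1 := cov_commutator_tensorial (curvature_tensorial3 sY sZ) sX.
have t2 := curvature_tensorial3 (cov_smooth sX sY) sZ.
have t3 := curvature_tensorial3 sY (cov_smooth sX sZ).
apply: (eq_tensorial _ (tensorialB (tensorialB t1 t2) t3)) => W sW.
by rewrite /nabla_curvature /= -!addrA; congr (_ + _); rewrite [LHS]addrC -addrA.
Qed.

Lemma curvature_at X X' Y Y' Z Z' p :
  smooth_field X -> smooth_field X' -> smooth_field Y -> smooth_field Y' ->
  smooth_field Z -> smooth_field Z' -> X p = X' p -> Y p = Y' p -> Z p = Z' p ->
  curvature nabla X Y Z p = curvature nabla X' Y' Z' p.
Proof.
move=> sX sX' sY sY' sZ sZ' eX eY eZ.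
rewrite (tensorial_at (curvature_tensorial1 sY sZ) sX sX' eX).
rewrite (tensorial_at (curvature_tensorial2 sX' sZ) sY sY' eY).
exact: (tensorial_at (curvature_tensorial3 sX' sY') sZ sZ' eZ).
Qed.

Lemma nabla_curvature_at X X' Y Y' Z Z' W W' p :
  smooth_field X -> smooth_field X' -> smooth_field Y -> smooth_field Y' ->
  smooth_field Z -> smooth_field Z' -> smooth_field W -> smooth_field W' ->
  X p = X' p -> Y p = Y' p -> Z p = Z' p -> W p = W' p ->
  nabla_curvature nabla X Y Z W p = nabla_curvature nabla X' Y' Z' W' p.
Proof.
move=> sX sX' sY sY' sZ sZ' sW sW' eX eY eZ eW.
rewrite (tensorial_at (nabla_curvature_tensorial1 sY sZ sW) sX sX' eX).
rewrite (tensorial_at (nabla_curvature_tensorial2 sX' sZ sW) sY sY' eY).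
rewrite (tensorial_at (nabla_curvature_tensorial3 sX' sY' sW) sZ sZ' eZ).
exact: (tensorial_at (nabla_curvature_tensorial4 sX' sY' sZ') sW sW' eW).
Qed.

End Tensoriality.

(** * Left-invariant fields *)

Section LinearMaps.
Context {R : realType} {n : nat}.
Local Notation E := 'cV[R]_n.

Lemma smooth_scalar (f : E -> R) : scalar f -> smooth f.
Proof.
move=> lf; rewrite (_ : f = fun p => \sum_i f (delta_mx i 0) * p i 0).
  by apply: smooth_sum => i; apply/smoothMl/smooth_coord.
apply/funext => p.
rewrite {1}[p]matrix_sum_delta; under eq_bigr => i _ do rewrite big_ord1.
by elim/big_rec2: _ => [|i a y _ <-]; rewrite ?scalar0 // lf mulrC.
Qed.

Lemma derive_scalar (f : E -> R) x v : scalar f -> 'D_v f x = f v.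
Proof.
move=> lf; pose L := GRing.isLinear.Build _ _ _ _ _ lf.
pose c : {linear E -> R} := HB.pack f L.
have cf : continuous c by exact: smooth_continuous (smooth_scalar lf).
rewrite (_ : f = c) // deriveE; last exact: linear_differentiable.
by rewrite diff_lin.
Qed.

Lemma linear_continuous_cV m (f : {linear E -> 'cV[R]_m}) : continuous f.
Proof.
pose c i (p : E) := p i 0 *: f (delta_mx i 0).
have -> : (f : E -> _) = \sum_i c i.
  apply/funext => p; rewrite fct_sumE {1}[p]matrix_sum_delta linear_sum.
  by apply: eq_bigr => i _; rewrite big_ord1 linearZ.
elim/big_ind: _ => [p|g h cg ch p|i _ p].
- exact: cst_continuous.
- exact: (continuousD (cg p) (ch p)).
- exact: (continuousZr_tmp (@coord_continuous _ _ _ i 0 p)).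
Qed.

End LinearMaps.

Section LeftInvariantFields.
Context {R : realType} {m r : nat} (j : {linear 'cV[R]_r -> 'M[R]_m}).
Hypothesis soj : so_valued j.
Local Notation V := 'cV[R]_(m + r).
Implicit Types (u v w x p : V).

Lemma bracket_form u v w : dot (bracket j u v) w = j_form j w v u.
Proof.
transitivity (dot (dsubmx w) (bracket_v j (usubmx u) (usubmx v))).
  rewrite /bracket -{1}[w]vsubmxK /dot big_split_ord /= big1 ?add0r => [|i _].
    by apply: eq_bigr => i _; rewrite !col_mxEd mulrC.
  by rewrite col_mxEu mxE mul0r.
by rewrite -bracket_vP dotC dotE mulmxA.
Qed.

Lemma j_form1 y z : scalar (fun x => j_form j x y z).
Proof.
move=> a x x'; rewrite /j_form linearP /= linearP /= mulmxDr mulmxDl -scalemxAr -scalemxAl.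
by rewrite !mxE.
Qed.

Lemma j_form2 x z : scalar (fun y => j_form j x y z).
Proof.
move=> a y y'; rewrite /j_form linearP /= linearP /= !mulmxDl -!scalemxAl.
by rewrite !mxE.
Qed.

Lemma j_form3 x y : scalar (fun z => j_form j x y z).
Proof. by move=> a z z'; rewrite /j_form linearP /= mulmxDr -scalemxAr !mxE. Qed.

Lemma j_form_antisym x y z : j_form j x y z = - j_form j x z y.
Proof.
rewrite /j_form; set A := _ *m _; have -> : A 0 0 = A^T 0 0 by rewrite [RHS]mxE.
by rewrite /A !trmx_mul trmxK soj mulNmx mulmxN mulmxA mxE.
Qed.

Lemma bracket_linear1 w : linear (bracket j ^~ w).
Proof.
by move=> a u v; apply: dot_inj => x; rewrite dotDl dotZl !bracket_form j_form3.
Qed.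

Lemma bracket_linear2 u : linear (bracket j u).
Proof.
by move=> a v w; apply: dot_inj => x; rewrite dotDl dotZl !bracket_form j_form2.
Qed.

Lemma bracketZl a u w : bracket j (a *: u) w = a *: bracket j u w.
Proof. by apply: dot_inj => x; rewrite dotZl !bracket_form (scalar_homo (j_form3 _ _)). Qed.

Lemma bracketZr a u w : bracket j u (a *: w) = a *: bracket j u w.
Proof. by apply: dot_inj => x; rewrite dotZl !bracket_form (scalar_homo (j_form2 _ _)). Qed.

Lemma bracketC u v : bracket j v u = - bracket j u v.
Proof. by apply: dot_inj => x; rewrite dotNl !bracket_form -j_form_antisym. Qed.

Lemma bracket_central u v w : bracket j u (bracket j v w) = 0.
Proof.
apply: dot_inj => x; rewrite bracket_form /j_form /bracket col_mxKu trmx0 !mul0mx mxE.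
by rewrite dotC (scalar0 (dot_scalar x)).
Qed.

(** Differential at p of the left translation that maps p to the identity. *)
Definition to_identity p u : V := u - 2^-1 *: bracket j p u.

Lemma to_identity_linear p : linear (to_identity p).
Proof.
move=> a v w; rewrite /to_identity bracket_linear2 !scalerDr scalerA opprD.
by rewrite [2^-1 * a]mulrC -scalerA addrACA scalerN.
Qed.

Lemma to_identityB p u v : to_identity p (u - v) = to_identity p u - to_identity p v.
Proof. by rewrite addrC -scaleN1r to_identity_linear scaleN1r addrC. Qed.

Lemma diff_left_translation p u : 'd (gmul j (ginv p)) p u = to_identity p u.
Proof.
pose L := GRing.isLinear.Build _ _ _ _ _ (to_identity_linear p).
pose c : {linear V -> V} := HB.pack (to_identity p) L.
have cc : continuous c by exact: linear_continuous_cV.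
have dc q : differentiable c q by exact: linear_differentiable.
have -> : gmul j (ginv p) = cst (- p) + c.
  apply/funext => q; rewrite fctE /= /gmul /ginv /to_identity -addrA; congr (_ + (_ + _)).
  by rewrite -scaleN1r bracketZl scaleN1r scalerN.
have dk : differentiable (cst (- p) : V -> V) p by exact: differentiable_cst.
have at_u (h h' : V -> V) : h = h' -> h u = h' u by move->.
apply: (etrans (at_u _ _ (diffD dk (dc p)))).
apply: (etrans (congr2 +%R (at_u _ _ (diff_cst (- p) p)) (at_u _ _ (diff_lin p cc)))).
exact: add0r.
Qed.

Lemma left_metricE p u w : left_metric j p u w = dot (to_identity p u) (to_identity p w).
Proof. by rewrite /left_metric !diff_left_translation. Qed.

(** The left-invariant field with value v at the identity. *)
Definition left_field v : V -> V := fun p => v + 2^-1 *: bracket j p v.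

Lemma to_identity_left_field v p : to_identity p (left_field v p) = v.
Proof.
rewrite /to_identity /left_field bracketDr bracketZr bracket_central scaler0 addr0.
by rewrite addrK.
Qed.

Lemma left_field_to_identity u p : left_field (to_identity p u) p = u.
Proof.
rewrite /to_identity /left_field bracketDr -scaleN1r bracketZr bracketZr bracket_central.
by rewrite !scaler0 addr0 scaleN1r subrK.
Qed.

Lemma left_metric_left_field v w p :
  left_metric j p (left_field v p) (left_field w p) = dot v w.
Proof. by rewrite left_metricE !to_identity_left_field. Qed.

Lemma left_fieldD v w : left_field (v + w) = left_field v + left_field w.
Proof.
by apply/funext => p; rewrite fctE /left_field bracketDr scalerDr addrACA.
Qed.

Lemma left_fieldN v : left_field (- v) = - left_field v.
Proof.
apply/funext => p; rewrite fctE /left_field -scaleN1r bracketZr !scaleN1r scalerN.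
by rewrite opprD.
Qed.

Lemma left_fieldB v w : left_field (v - w) = left_field v - left_field w.
Proof. by rewrite left_fieldD left_fieldN. Qed.

Lemma bracket_coord_scalar w i : scalar (fun p => bracket j p w i 0).
Proof. by move=> a u v; rewrite bracket_linear1 !mxE. Qed.

Lemma smooth_left_field v : smooth_field (left_field v).
Proof.
move=> i; rewrite (_ : (fun p => _) = fun p => cst (v i 0) p + 2^-1 * bracket j p v i 0).
  apply: smoothD; first exact: smooth_cst.
  by apply/smoothMl/smooth_scalar/bracket_coord_scalar.
by apply/funext => p; rewrite mxE [X in _ + X]mxE.
Qed.

(** The derivative of one field along the other is half the bracket. *)
Lemma lie_bracket_left_field v w :
  lie_bracket (left_field v) (left_field w) = left_field (bracket j v w).
Proof.
have D u x i p : lie_derivative (left_field u) (fun q => left_field x q i 0) p =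
    2^-1 * bracket j u x i 0.
  rewrite /lie_derivative (_ : (fun q => _) =
      cst (x i 0) + (fun q => 2^-1 * bracket j q x i 0)); last first.
    by apply/funext => q; rewrite mxE [X in _ + X]mxE.
  have sc : scalar (fun q => 2^-1 * bracket j q x i 0).
    exact/scalarMl/bracket_coord_scalar.
  rewrite deriveD; last 2 first.
  - exact: derivable_cst.
  - exact/smooth_derivable/smooth_scalar.
  rewrite derive_cst add0r derive_scalar // /left_field bracketDl bracketZl.
  by rewrite [bracket j (bracket j _ _) _]bracketC bracket_central oppr0 scaler0 addr0.
apply/funext => p; apply/colP => i; rewrite mxE !D (bracketC v w).
rewrite /left_field bracket_central scaler0 addr0 [X in _ - _ * X]mxE; lra.
Qed.

Definition left_conn u v : V := \col_k connection_form j u v (delta_mx k 0).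

Lemma connection_form1 y z : scalar (fun x => connection_form j x y z).
Proof.
move=> a x x'; rewrite /connection_form (j_form3 _ _ a) (j_form1 _ _ a) (j_form2 _ _ a).
ring.
Qed.

Lemma connection_form2 x z : scalar (fun y => connection_form j x y z).
Proof.
move=> a y y'; rewrite /connection_form (j_form3 _ _ a) (j_form1 _ _ a) (j_form2 _ _ a).
ring.
Qed.

Lemma connection_form3 x y : scalar (fun z => connection_form j x y z).
Proof.
move=> a z z'; rewrite /connection_form (j_form3 _ _ a) (j_form1 _ _ a) (j_form2 _ _ a).
ring.
Qed.

Lemma dot_left_conn u v w : dot (left_conn u v) w = connection_form j u v w.
Proof.
have [on_std] : orthonormal_basis (fun k => delta_mx k 0 : V) /\ True.
  by split=> // i k; rewrite dot_delta mxE eqxx andbT eq_sym.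
rewrite (scalar_expand w on_std (connection_form3 u v)) => _.
by apply: eq_bigr => k _; rewrite mxE dot_delta mulrC.
Qed.

Lemma left_conn_linear1 v : linear (left_conn ^~ v).
Proof.
move=> a u u'; apply: dot_inj => w.
by rewrite dotDl dotZl !dot_left_conn connection_form1.
Qed.

Lemma left_conn_linear2 u : linear (left_conn u).
Proof.
move=> a v v'; apply: dot_inj => w.
by rewrite dotDl dotZl !dot_left_conn connection_form2.
Qed.

Variable nabla : (V -> V) -> (V -> V) -> V -> V.
Hypothesis LC : is_levi_civita (left_metric j) nabla.

(** Koszul's formula. Scalar products of left-invariant fields are constant, so
    the metric condition reads <nabla_a b, c> + <nabla_a c, b> = 0; with the
    vanishing torsion these linear equations determine all <nabla_a b, c>. *)
Lemma nabla_left_field u v : nabla (left_field u) (left_field v) = left_field (left_conn u v).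
Proof.
apply/funext => p.
rewrite -[LHS](left_field_to_identity _ p); congr (left_field _ p).
pose G u v := to_identity p (nabla (left_field u) (left_field v) p).
have metric a b c : dot (G a b) c + dot (G a c) b = 0.
  have := congr1 (fun h => h p) (nabla_metric LC (smooth_left_field a) (smooth_left_field b)
    (smooth_left_field c)).
  rewrite (_ : (fun q => left_metric j q _ _) = cst (dot b c)); last first.
    by apply/funext => q; rewrite left_metric_left_field.
  rewrite /lie_derivative derive_cst !left_metricE !to_identity_left_field.
  by rewrite [dot b _]dotC.
have torsion a b c : dot (G a b) c - dot (G b a) c = j_form j c b a.
  have := congr1 (fun h => dot (to_identity p (h p)) c)
    (nabla_torsion_free LC (smooth_left_field a) (smooth_left_field b)).
  rewrite lie_bracket_left_field to_identity_left_field bracket_form => <-.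
  by rewrite -dotBl; congr dot; rewrite /G -to_identityB.
apply: dot_inj => w; rewrite dot_left_conn /connection_form -/(G u v).
clearbody G; rewrite -(torsion u v w) -(torsion v w u) -(torsion w u v).
have := (metric u v w, metric v u w, metric w u v).
move: (dot (G u v) w) (dot (G u w) v) (dot (G v u) w) (dot (G v w) u) (dot (G w u) v)
  (dot (G w v) u) => a b c d x y [[]]; lra.
Qed.

Lemma curvature_left_field x y z :
  curvature nabla (left_field x) (left_field y) (left_field z) =
  left_field (alg_curv left_conn x y z).
Proof.
rewrite /curvature -(nabla_torsion_free LC); try exact: smooth_left_field.
by rewrite !nabla_left_field -left_fieldB !nabla_left_field -!left_fieldB.
Qed.

Lemma nabla_curvature_left_field s x y z :
  nabla_curvature nabla (left_field s) (left_field x) (left_field y) (left_field z) =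
  left_field (alg_dcurv left_conn s x y z).
Proof.
by rewrite /nabla_curvature !(nabla_left_field, curvature_left_field) -!left_fieldB.
Qed.

Section Frame.
Variables (p : V) (e : 'I_(m + r) -> V -> V).
Hypothesis onf : orthonormal_frame_at (left_metric j) p e.

Definition frame_at_identity i : V := to_identity p (e i p).
Local Notation u := frame_at_identity.

Lemma orthonormal_frame_at_identity : orthonormal_basis u.
Proof. by case: onf => _ on i k; rewrite -on left_metricE. Qed.

Lemma frame_left_field i : e i p = left_field (u i) p.
Proof. by rewrite left_field_to_identity. Qed.

Lemma RmE i k l n : Rm (left_metric j) nabla p e i k l n =
  dot (alg_curv left_conn (u i) (u k) (u l)) (u n).
Proof.
have [se _] := onf; have sF := smooth_left_field.
rewrite /Rm (curvature_at LC (se i) (sF _) (se k) (sF _) (se l) (sF _)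
  (frame_left_field i) (frame_left_field k) (frame_left_field l)).
by rewrite curvature_left_field (frame_left_field n) left_metric_left_field.
Qed.

Lemma nabla_RmE s i k l n : nabla_Rm (left_metric j) nabla p e s i k l n =
  dot (alg_dcurv left_conn (u s) (u i) (u k) (u l)) (u n).
Proof.
have [se _] := onf; have sF := smooth_left_field.
rewrite /nabla_Rm (nabla_curvature_at LC (se s) (sF _) (se i) (sF _) (se k) (sF _)
  (se l) (sF _)
  (frame_left_field s) (frame_left_field i) (frame_left_field k) (frame_left_field l)).
by rewrite nabla_curvature_left_field (frame_left_field n) left_metric_left_field.
Qed.

Variable Z : 'I_r -> 'cV[R]_r.
Hypothesis onZ : orthonormal_basis Z.

Lemma orthonormal_adapted_frame : orthonormal_basis (adapted_frame Z : 'I_(m + r) -> V).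
Proof.
have dot_col (a b : 'cV[R]_m) (c d : 'cV[R]_r) :
    dot (col_mx a c) (col_mx b d) = dot a b + dot c d.
  rewrite /dot big_split_ord; congr (_ + _); apply: eq_bigr => i _;
  by rewrite ?col_mxEu ?col_mxEd.
have dot0 k (a : 'cV[R]_k) : dot a 0 = 0 by rewrite (scalar0 (dot_scalar a)).
move=> k l; rewrite -[k]splitK -[l]splitK.
case: (fintype.split k) => i; case: (fintype.split l) => h;
  rewrite /= ?adapted_frame_lshift ?adapted_frame_rshift dot_col.
- by rewrite dot0 addr0 dot_delta mxE eqxx andbT (inj_eq (@lshift_inj _ _)) eq_sym.
- by rewrite dot0 dotC dot0 addr0 eq_lrshift.
- by rewrite dotC dot0 dot0 addr0 eq_rlshift.
- by rewrite dot0 add0r onZ (inj_eq (@rshift_inj _ _)).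
Qed.

Local Notation graph_sum P := (isum (adapted_frame Z) (iota 0 9)
  (fun rho => gp_val (connection_form j) rho P) (fun=> 0)).

Lemma graph_sumE P : isum (adapted_frame Z) (iota 0 9)
  (fun rho => gp_val (fun x y z => dot (left_conn x y) z) rho P) (fun=> 0) = graph_sum P.
Proof.
rewrite (_ : (fun x y z => dot (left_conn x y) z) = connection_form j) //.
by do 3! apply/funext => ?; rewrite dot_left_conn.
Qed.

Lemma R_hat_graph : R_hat (left_metric j) nabla p e = graph_sum hat_graph.
Proof.
rewrite -graph_sumE -(hat_sum left_conn_linear1 left_conn_linear2
  orthonormal_adapted_frame orthonormal_frame_at_identity).
by do 6! (apply: eq_bigr => ? _); rewrite !RmE.
Qed.

Lemma R_ring_graph : R_ring (left_metric j) nabla p e = graph_sum ring_graph.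
Proof.
rewrite -graph_sumE -(ring_sum left_conn_linear1 left_conn_linear2
  orthonormal_adapted_frame orthonormal_frame_at_identity).
by do 6! (apply: eq_bigr => ? _); rewrite !RmE.
Qed.

Lemma norm_nabla_R_graph : norm_nabla_R_sqr (left_metric j) nabla p e = graph_sum norm_graph.
Proof.
rewrite -graph_sumE -(norm_sum left_conn_linear1 left_conn_linear2
  orthonormal_adapted_frame orthonormal_frame_at_identity).
by do 5! (apply: eq_bigr => ? _); rewrite nabla_RmE.
Qed.

End Frame.

End LeftInvariantFields.

(** * The coefficients of the triangle invariant *)

Theorem lemma13 (R : realType) :
  exists L1 L2 L3 : seq (R * seq (seq 'I_3)),
    [/\ even_combination L1, even_combination L2 & even_combination L3] /\
    forall (m r : nat) (j : {linear 'cV[R]_r -> 'M[R]_m})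
      (Z : 'I_r -> 'cV[R]_r)
      (nabla : ('cV[R]_(m + r) -> 'cV[R]_(m + r)) ->
               ('cV[R]_(m + r) -> 'cV[R]_(m + r)) ->
               'cV[R]_(m + r) -> 'cV[R]_(m + r))
      (p : 'cV[R]_(m + r))
      (e : 'I_(m + r) -> 'cV[R]_(m + r) -> 'cV[R]_(m + r)),
    so_valued j ->
    orthonormal_basis Z ->
    is_levi_civita (left_metric j) nabla ->
    orthonormal_frame_at (left_metric j) p e ->
    let I := trace_invariant Z j pattern_123_123 in
    [/\ norm_nabla_R_sqr (left_metric j) nabla p e
          = - (3 / 2) * I + combination_value L1 Z j,
        R_hat (left_metric j) nabla p e
          = - (7 / 16) * I + combination_value L2 Z j
      & R_ring (left_metric j) nabla p e
          = - (17 / 64) * I + combination_value L3 Z j].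
Proof.
have [L1 [even1 val1]] := certified_combination R norm_certificate.
have [L2 [even2 val2]] := certified_combination R hat_certificate.
have [L3 [even3 val3]] := certified_combination R ring_certificate.
exists L1, L2, L3; split=> // m r j Z nabla p e soj onZ LC onf I; split.
- rewrite (norm_nabla_R_graph soj LC onf onZ) val1 //; congr (_ * _ + _); lra.
- rewrite (R_hat_graph soj LC onf onZ) val2 //; congr (_ * _ + _); lra.
- rewrite (R_ring_graph soj LC onf onZ) val3 //; congr (_ * _ + _); lra.
Qed.
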